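(* Let $K$ be a finite extension of $\mathbb{Q}$ and $f:\mathbb{N}\to K$ a multiplicative function. Suppose $F(z)=\sum_{n\geq 1}f(n)z^n\in K[[z]]$ is algebraic over $K(z)$. Then either $f(n)$ is eventually zero or there is a nonnegative integer $k$ and a periodic multiplicative function $\chi:\mathbb{N}\to K$ such that $f(n)=n^k\chi(n)$ for all $n\in\mathbb{N}$.
   Context: $\mathbb{N}=\{1,2,3,\ldots\}$. A function $f$ on $\mathbb{N}$ is multiplicative if $f(mn)=f(m)f(n)$ whenever $\gcd(m,n)=1$. A function $\chi$ is periodic if there is $d\in\mathbb{N}$ with $\chi(n+d)=\chi(n)$ for all $n$. *)

(* Defs.v *)
From HB Require Import structures.
From mathcomp Require Import all_boot all_order all_algebra all_field.
From mathcomp Require Import boolp.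

Set Implicit Arguments.
Unset Strict Implicit.
Unset Printing Implicit Defensive.

Import GRing.Theory.
Local Open Scope ring_scope.

Section ArithmeticFunctions.
Variable K : fieldType.

(* Arithmetic functions have domain {1, 2, 3, ...}; they are represented by    *)
(* functions on nat whose value at 0 is irrelevant.                            *)
Definition multiplicative_fun (f : nat -> K) : Prop :=
  forall m n : nat, (0 < m)%N -> (0 < n)%N -> coprime m n ->
    f (m * n)%N = f m * f n.

Definition periodic_fun (chi : nat -> K) : Prop :=
  exists2 d : nat, (0 < d)%N & forall n : nat, (0 < n)%N -> chi (n + d)%N = chi n.

Definition eventually_zero (f : nat -> K) : Prop :=
  exists N : nat, forall n : nat, (N <= n)%N -> f n = 0.

End ArithmeticFunctions.

(* The ring K[[z]]: [Fps a] is the series \sum_n (a n) z^n.                     *)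
Record fps (K : fieldType) := Fps { fcoef : nat -> K }.

HB.instance Definition _ (K : fieldType) := gen_eqMixin (fps K).
HB.instance Definition _ (K : fieldType) := gen_choiceMixin (fps K).

Section PowerSeries.
Variable K : fieldType.
Implicit Types a b c : fps K.

Lemma fpsP a b : (forall n, fcoef a n = fcoef b n) -> a = b.
Proof. by case: a b => [a] [b] /= eq_ab; congr Fps; apply/funext. Qed.

Definition fps_zero : fps K := Fps (fun=> 0).
Definition fps_one : fps K := Fps (fun n => (n == 0%N)%:R).
Definition fps_opp a : fps K := Fps (fun n => - fcoef a n).
Definition fps_add a b : fps K := Fps (fun n => fcoef a n + fcoef b n).
Definition fps_mul a b : fps K :=
  Fps (fun n => \sum_(j < n.+1) fcoef a j * fcoef b (n - j)%N).

Fact fps_addA : associative fps_add.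
Proof. by move=> a b c; apply: fpsP => n /=; rewrite addrA. Qed.
Fact fps_addC : commutative fps_add.
Proof. by move=> a b; apply: fpsP => n /=; rewrite addrC. Qed.
Fact fps_add0 : left_id fps_zero fps_add.
Proof. by move=> a; apply: fpsP => n /=; rewrite add0r. Qed.
Fact fps_addN : left_inverse fps_zero fps_opp fps_add.
Proof. by move=> a; apply: fpsP => n /=; rewrite addNr. Qed.

HB.instance Definition _ :=
  GRing.isZmodule.Build (fps K) fps_addA fps_addC fps_add0 fps_addN.

Definition fps_trunc (m : nat) a : {poly K} := \poly_(i < m) fcoef a i.

Lemma fps_mul_trunc m n a b : (n < m)%N ->
  fcoef (fps_mul a b) n = (fps_trunc m a * fps_trunc m b)`_n.
Proof.
move=> lt_nm; rewrite coefM /=; apply: eq_bigr => j _.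
have le_jn : (j <= n)%N by rewrite -ltnS.
by rewrite !coef_poly (leq_ltn_trans le_jn) // (leq_ltn_trans (leq_subr _ _)).
Qed.

Fact fps_mulC : commutative fps_mul.
Proof.
by move=> a b; apply: fpsP => n; rewrite !(fps_mul_trunc _ _ (ltnSn n)) mulrC.
Qed.

Fact fps_mulA : associative fps_mul.
Proof.
move=> a b c; apply: fpsP => n; pose t := fps_trunc n.+1.
have eql : fcoef (fps_mul a (fps_mul b c)) n = (t a * (t b * t c))`_n.
  rewrite coefM /=; apply: eq_bigr => j _; have le_jn : (j <= n)%N by rewrite -ltnS.
  rewrite -(@fps_mul_trunc n.+1) ?ltnS ?leq_subr //.
  by rewrite /t coef_poly ltnS le_jn.
have eqr : fcoef (fps_mul (fps_mul a b) c) n = (t a * t b * t c)`_n.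
  rewrite coefM /=; apply: eq_bigr => j _.
  by rewrite -(@fps_mul_trunc n.+1) // /t coef_poly ltnS leq_subr.
by rewrite eql eqr mulrA.
Qed.

Fact fps_mul1 : left_id fps_one fps_mul.
Proof.
move=> a; apply: fpsP => n /=; rewrite big_ord_recl /= subn0 mul1r big1 ?addr0 //.
by move=> i _; rewrite mul0r.
Qed.

Fact fps_mulDl : left_distributive fps_mul fps_add.
Proof.
move=> a b c; apply: fpsP => n /=; rewrite -big_split /=.
by apply: eq_bigr => j _; rewrite mulrDl.
Qed.

Fact fps_one_neq0 : fps_one != 0.
Proof. by apply/eqP => /(congr1 (fun a => fcoef a 0)) /eqP; rewrite /= oner_eq0. Qed.

HB.instance Definition _ := GRing.Zmodule_isComNzRing.Build (fps K)
  fps_mulA fps_mulC fps_mul1 fps_mulDl fps_one_neq0.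

Definition fps_unit : pred (fps K) := fun a => `[< exists b, b * a = 1 >].
Definition fps_inv a : fps K :=
  if pselect (exists b, b * a = 1) is left ex_b then projT1 (cid ex_b) else a.

Fact fps_mulV : {in fps_unit, left_inverse 1 fps_inv *%R}.
Proof.
move=> a /asboolP ua; rewrite /fps_inv; case: pselect => // ex_b.
exact: projT2 (cid ex_b).
Qed.
Fact fps_unitPl a b : b * a = 1 -> fps_unit a.
Proof. by move=> ba1; apply/asboolP; exists b. Qed.
Fact fps_inv_out : {in [predC fps_unit], fps_inv =1 id}.
Proof.
move=> a /negP nua; rewrite /fps_inv; case: pselect => // ex_b.
by case: nua; apply/asboolP.
Qed.

HB.instance Definition _ := GRing.ComNzRing_hasMulInverse.Build (fps K)
  fps_mulV fps_unitPl fps_inv_out.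

Lemma fps_neq0_order a : a != 0 ->
  exists2 i, fcoef a i != 0 & forall j, (j < i)%N -> fcoef a j = 0.
Proof.
move=> nz_a; have ex_i : exists i, fcoef a i != 0.
  apply: contrapT => no_i; case/eqP: nz_a; apply: fpsP => n /=.
  by apply: contrapT => /eqP nz; apply: no_i; exists n.
case: (ex_minnP ex_i) => i nz_ai min_i; exists i => // j lt_ji.
by apply: contraTeq lt_ji => /min_i; rewrite -leqNgt.
Qed.

Fact fps_mulf_eq0 : GRing.integral_domain_axiom (fps K).
Proof.
move=> a b ab0; apply: contrapT => /negP; rewrite negb_or => /andP[].
move=> /fps_neq0_order[i nz_ai lt_i] /fps_neq0_order[j nz_bj lt_j].
have /eqP := congr1 (fun c => fcoef c (i + j)%N) ab0.
have lt_iij : (i < (i + j).+1)%N by rewrite ltnS leq_addr.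
rewrite /= (bigD1 (Ordinal lt_iij)) //= addKn big1 ?addr0 => [|k ne_ki].
  by rewrite mulf_eq0 (negPf nz_ai) (negPf nz_bj).
case: (ltngtP k i) => [/lt_i->|lt_ik|eq_ki]; first by rewrite mul0r.
  rewrite [fcoef b _]lt_j ?mulr0 // ltn_subLR ?ltn_add2r // -ltnS.
  exact: ltn_ord.
by case/eqP: ne_ki; apply: val_inj.
Qed.

HB.instance Definition _ := GRing.ComUnitRing_isIntegral.Build (fps K)
  fps_mulf_eq0.

Definition fps_of_poly (p : {poly K}) : fps K := Fps (fun n => p`_n).

Fact fps_of_poly_is_zmod_morphism : zmod_morphism fps_of_poly.
Proof. by move=> p q; apply: fpsP => n /=; rewrite coefB. Qed.
HB.instance Definition _ := GRing.isZmodMorphism.Build {poly K} (fps K)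
  fps_of_poly fps_of_poly_is_zmod_morphism.
Fact fps_of_poly_is_monoid_morphism : monoid_morphism fps_of_poly.
Proof.
by split=> [|p q]; apply: fpsP => n /=; rewrite ?coef1 // coefM.
Qed.
HB.instance Definition _ := GRing.isMonoidMorphism.Build {poly K} (fps K)
  fps_of_poly fps_of_poly_is_monoid_morphism.

Lemma fps_of_poly_inj : injective fps_of_poly.
Proof.
by move=> p q pq; apply/polyP => n; exact: (congr1 (fun a => fcoef a n) pq).
Qed.

End PowerSeries.

Notation ratfun K := {fraction {poly K}}.

(* The field K((z)), as the field of fractions of K[[z]].                      *)
Notation laurent K := {fraction (fps K)}.

Section RationalFunctions.
Variable K : fieldType.

Local Notation "x %:F" := (FracField.tofrac x).

(* The embedding of K(z) in K((z)) extending that of K[z] in K[[z]].           *)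
Definition laurent_of_ratfun (u : ratfun K) : laurent K :=
  (fps_of_poly \n_(repr u))%:F / (fps_of_poly \d_(repr u))%:F.

Lemma ratfunE (u : ratfun K) : u = (\n_(repr u))%:F / (\d_(repr u))%:F.
Proof.
rewrite -[LHS]reprK; move: (repr u) => x; unlock FracField.tofrac.
rewrite -[X in _ = _ * X]FracField.pi_inv -[RHS]FracField.pi_mul.
rewrite /FracField.mulf /FracField.invf.
by rewrite !numden_Ratio ?oner_eq0 ?denom_ratioP // mulr1 mul1r Ratio_numden.
Qed.

Lemma fps_of_poly_frac_eq0 (p : {poly K}) :
  ((fps_of_poly p)%:F == 0 :> laurent K) = (p == 0).
Proof. by rewrite tofrac_eq0 -(inj_eq (@fps_of_poly_inj K)) rmorph0. Qed.

Lemma laurent_of_ratfun_frac (p q : {poly K}) : q != 0 ->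
  laurent_of_ratfun (p%:F / q%:F) = (fps_of_poly p)%:F / (fps_of_poly q)%:F.
Proof.
move=> nz_q; rewrite /laurent_of_ratfun; set u : ratfun K := p%:F / q%:F.
have nz_d : \d_(repr u) != 0 by apply: denom_ratioP.
have /eqP := ratfunE u; rewrite {1}/u eqr_div ?tofrac_eq0 // -!tofracM tofrac_eq.
move=> /eqP eq_pq; apply/eqP; rewrite eqr_div ?fps_of_poly_frac_eq0 //.
by rewrite -!tofracM -!rmorphM eq_pq.
Qed.

Lemma laurent_of_ratfun_tofrac (p : {poly K}) :
  laurent_of_ratfun p%:F = (fps_of_poly p)%:F.
Proof.
rewrite -[p%:F]divr1 -tofrac1 laurent_of_ratfun_frac ?oner_eq0 //.
by rewrite rmorph1 tofrac1 divr1.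
Qed.

Fact laurent_of_ratfun_is_zmod_morphism : zmod_morphism laurent_of_ratfun.
Proof.
move=> u v; rewrite (ratfunE u) (ratfunE v).
move: (denom_ratioP (repr u)) (denom_ratioP (repr v)).
move: \n_(repr u) \d_(repr u) \n_(repr v) \d_(repr v) => p q r s nz_q nz_s.
rewrite -mulNr addf_div ?tofrac_eq0 // -tofracN -!tofracM -tofracD.
rewrite !laurent_of_ratfun_frac ?mulf_neq0 // -mulNr addf_div ?fps_of_poly_frac_eq0 //.
by rewrite -tofracN -!tofracM -tofracD !(rmorphD, rmorphM, rmorphN).
Qed.
HB.instance Definition _ := GRing.isZmodMorphism.Build (ratfun K) (laurent K)
  laurent_of_ratfun laurent_of_ratfun_is_zmod_morphism.

Fact laurent_of_ratfun_is_monoid_morphism : monoid_morphism laurent_of_ratfun.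
Proof.
split=> [|u v]; first by rewrite -tofrac1 laurent_of_ratfun_tofrac rmorph1 tofrac1.
rewrite (ratfunE u) (ratfunE v).
move: (denom_ratioP (repr u)) (denom_ratioP (repr v)).
move: \n_(repr u) \d_(repr u) \n_(repr v) \d_(repr v) => p q r s nz_q nz_s.
rewrite mulf_div -!tofracM !laurent_of_ratfun_frac ?mulf_neq0 //.
by rewrite mulf_div -!tofracM -!rmorphM.
Qed.
HB.instance Definition _ := GRing.isMonoidMorphism.Build (ratfun K) (laurent K)
  laurent_of_ratfun laurent_of_ratfun_is_monoid_morphism.

(* Algebraicity over K(z), in the extension field K((z)) of K(z) and K[[z]].     *)
Definition fps_algebraic (F : fps K) : Prop :=
  algebraicOver laurent_of_ratfun F%:F.

(* The series \sum_(n >= 1) f(n) z^n, with no constant term.                   *)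
Definition gen_fps (f : nat -> K) : fps K :=
  Fps (fun n => if n == 0%N then 0 else f n).

End RationalFunctions.

(* Main.v *)
From HB Require Import structures.
Require Import Defs.
From mathcomp Require Import all_boot all_order all_algebra all_field.
From mathcomp Require Import cyclic boolp classical_sets filter zify ring.

(** An algebraic series is differentially finite, so [f] satisfies a recurrence with
polynomial coefficients. If [f] vanished at powers of infinitely many primes, the Chinese
remainder theorem would produce arbitrarily late windows of zeros, and [f] would be eventually
zero. Otherwise, for a large prime [l], the sequence [f (l * n) - f l * f n] is supported on the
multiples of [l] and satisfies a recurrence of order less than [l], hence it is zero: [f] is
completely multiplicative, and nonzero, on the integers prime to some [Q].

Then [G a = f (Q * a + 1)] satisfies [G (M * a + 1) = G 1 * G a] with [M = Q + 1]. Let [A_n]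
be the matrix over [K(x)] that takes a window of [G] at [a] to the window at [a + n].
Dilation shows that [A_(M n) (M x + 1)] is conjugate, by a fixed rational matrix, to [A_n (x)],
so the degrees of [A_n] grow only logarithmically in [n]. Since the poles of [A_n] are
translates of finitely many points, all poles away from the two ends of the window must
cancel; counting dimensions then gives a polynomial [P] such that [P * G] satisfies a linear
recurrence with constant coefficients. Dilation also shows that the [M]-th power map permutes
its characteristic roots, which are therefore roots of unity, and [f] is a rational
function on some progression [1 + R N]; by multiplicativity it is [n ^ k] there, with [k] an
integer. The zero-window argument shows that [f n / n ^ k] is periodic. Finally [k < 0] is
impossible: a series [y] with [z y'] periodic is not algebraic, because an algebraic
antiderivative of a rational function is rational. *)

Set Implicit Arguments.
Unset Strict Implicit.
Unset Printing Implicit Defensive.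

Import GRing.Theory.
Local Open Scope classical_set_scope.
Local Open Scope ring_scope.

(** * Polynomials at large integers *)

Lemma near_affine (P : nat -> Prop) (a b : nat) : (0 < a)%N ->
  (\forall n \near \oo, P n) -> \forall n \near \oo, P (a * n + b)%N.
Proof. by move=> a_gt0 [N _ HN]; exists N => // n /= le_n; apply: HN => /=; nia. Qed.

Lemma near_addn (P : nat -> Prop) (b : nat) :
  (\forall n \near \oo, P (n + b)%N) <-> (\forall n \near \oo, P n).
Proof.
split=> [[N _ HN]|/(near_affine b (ltn0Sn 0))]; last first.
  by apply: filterS => n; rewrite mul1n.
exists (N + b)%N => // n /= le_n.
by rewrite -(subnK (_ : b <= n)%N); [apply: HN => /=|]; lia.
Qed.

Section NaturalPoints.
Variable C : fieldType.
Hypothesis pchar0 : has_pchar0 C.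
Implicit Type p : {poly C}.

Lemma pchar0_natr_eq0 (n : nat) : (n%:R == 0 :> C) = (n == 0)%N.
Proof. by move/pcharf0P: pchar0. Qed.

Lemma pchar0_natr_inj : injective (fun n : nat => n%:R : C).
Proof.
move=> m n; wlog le_mn : m n / (m <= n)%N => [hw /= eq_mn|/= eq_mn].
  by case/orP: (leq_total m n) => le; [|symmetry]; apply: hw.
have : (n - m)%:R == 0 :> C by rewrite natrB // eq_mn subrr.
by rewrite pchar0_natr_eq0; lia.
Qed.

Lemma near_horner_neq0 p : p != 0 -> \forall n \near \oo, p.[n%:R] != 0.
Proof.
have [s] := ubnP (size p); elim: s p => // s IHs p lt_ps nz_p.
have [[k rt_k]|no_root] := pselect (exists k : nat, root p k%:R); last first.
  by exists 0%N => // n _; apply/negP => rt_n; apply: no_root; exists n.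
have [q def_p] := factor_theorem _ _ rt_k.
have nz_q : q != 0 by apply: contraNneq nz_p => q0; rewrite def_p q0 mul0r.
rewrite def_p size_Mmonic ?monicXsubC // size_XsubC addn2 in lt_ps.
have gt_k : \forall n \near \oo, (k < n)%N by exists k.+1.
apply: filterS2 (IHs q lt_ps nz_q) gt_k => n nz_qn lt_kn.
rewrite def_p hornerM hornerXsubC mulf_neq0 // subr_eq0.
by rewrite (inj_eq pchar0_natr_inj) gtn_eqF.
Qed.

Lemma poly_eq0_progression p (a b : nat) : (0 < a)%N ->
  (\forall n \near \oo, p.[(a * n + b)%:R] = 0) -> p = 0.
Proof.
move=> a_gt0 p_zero; apply/eqP; apply: contrapT => /negP/near_horner_neq0/(near_affine b a_gt0).
by move/(filterI p_zero)/filter_ex => [n [-> /eqP]].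
Qed.

End NaturalPoints.

Section AffineSubstitution.
Variable F : fieldType.
Implicit Types (a b x : F) (p q : {poly F}).

Definition affine_subst a b : {poly F} -> {poly F} := comp_poly (a *: 'X + b%:P).
HB.instance Definition _ a b :=
  GRing.RMorphism.copy (affine_subst a b) (comp_poly (a *: 'X + b%:P)).

Lemma horner_affine_subst a b p x : (affine_subst a b p).[x] = p.[a * x + b].
Proof. by rewrite horner_comp !hornerE. Qed.

Lemma affine_subst_comp a b a' b' p :
  affine_subst a b (affine_subst a' b' p) = affine_subst (a' * a) (a' * b + b') p.
Proof.
rewrite /affine_subst -comp_polyA comp_polyD comp_polyZ comp_polyX comp_polyC.
by rewrite scalerDr scalerA -addrA polyCD polyCM mul_polyC.
Qed.

Lemma affine_subst_id p : affine_subst 1 0 p = p.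
Proof. by rewrite /affine_subst scale1r addr0 comp_polyXr. Qed.

Lemma affine_substK a b : a != 0 ->
  cancel (affine_subst a b) (affine_subst a^-1 (- (b / a))).
Proof.
move=> nz_a p; rewrite affine_subst_comp mulfV // mulrN mulrCA mulfV // mulr1.
by rewrite addNr affine_subst_id.
Qed.

Lemma affine_substVK a b : a != 0 ->
  cancel (affine_subst a^-1 (- (b / a))) (affine_subst a b).
Proof.
by move=> nz_a p; rewrite affine_subst_comp mulVf // mulrC subrr affine_subst_id.
Qed.

Lemma size_affine_subst a b p : a != 0 -> size (affine_subst a b p) = size p.
Proof.
move=> nz_a; apply: size_comp_poly2.
by rewrite -mul_polyC size_MXaddC polyC_eq0 (negPf nz_a) size_polyC nz_a.
Qed.

Lemma affine_subst_eq0 a b p : a != 0 -> (affine_subst a b p == 0) = (p == 0).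
Proof. by move=> nz_a; rewrite -!size_poly_eq0 size_affine_subst. Qed.

Lemma coprimep_affine_subst a b p q : a != 0 ->
  coprimep (affine_subst a b p) (affine_subst a b q) = coprimep p q.
Proof.
move=> nz_a; apply/idP/idP; last exact: coprimep_comp_poly.
move/(coprimep_comp_poly (a^-1 *: 'X + (- (b / a))%:P)).
by rewrite -!/(affine_subst _ _ _) !affine_substK.
Qed.

Lemma dvdp_affine_subst a b p q : a != 0 ->
  (affine_subst a b p %| affine_subst a b q) = (p %| q).
Proof.
move=> nz_a; apply/idP/idP; last exact: dvdp_comp_poly.
move/(dvdp_comp_poly (a^-1 *: 'X + (- (b / a))%:P)).
by rewrite -!/(affine_subst _ _ _) !affine_substK.
Qed.

Lemma horner_affine_subst_natr (a b n : nat) p :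
  (affine_subst a%:R b%:R p).[n%:R] = p.[(a * n + b)%:R].
Proof. by rewrite horner_affine_subst natrD natrM. Qed.

End AffineSubstitution.

Local Notation shiftp n := (affine_subst 1 n%:R).

Section Shift.
Variable F : fieldType.
Implicit Types p q : {poly F}.

Lemma horner_shiftp_natr (m n : nat) p : (shiftp n p).[m%:R] = p.[(m + n)%:R].
Proof. by rewrite horner_affine_subst mul1r natrD. Qed.

Lemma shiftpD (m n : nat) p : shiftp m (shiftp n p) = shiftp (m + n) p.
Proof. by rewrite affine_subst_comp !mul1r natrD. Qed.

Lemma shiftp_surj (n : nat) p : exists p', shiftp n p' = p.
Proof.
by exists (affine_subst 1 (- n%:R) p); rewrite affine_subst_comp !mul1r subrr affine_subst_id.
Qed.

Lemma size_shiftp (n : nat) p : size (shiftp n p) = size p.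
Proof. by rewrite size_affine_subst ?oner_eq0. Qed.

Lemma shiftp_eq0 (n : nat) p : (shiftp n p == 0) = (p == 0).
Proof. by rewrite affine_subst_eq0 ?oner_eq0. Qed.

Lemma coprimep_shiftp (n : nat) p q : coprimep (shiftp n p) (shiftp n q) = coprimep p q.
Proof. by rewrite coprimep_affine_subst ?oner_eq0. Qed.

End Shift.

(** * P-recursive sequences *)

Lemma exists_left_kernel (R : idomainType) (k l : nat) (A : 'M[R]_(k, l)) :
  (l < k)%N -> exists2 v : 'rV[R]_k, v != 0 & v *m A = 0.
Proof.
move=> lt_lk; pose B : 'M[R]_k := \matrix_(i, j) oapp (A i) 0 (insub (val j)).
have /det0P[v nz_v vB] : \det B == 0.
  rewrite (expand_det_col _ (Ordinal lt_lk)) big1 // => i _.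
  by rewrite mxE insubF ?ltnn ?mul0r.
exists v => //; apply/rowP => j.
have /rowP/(_ (widen_ord (ltnW lt_lk) j)) := vB; rewrite !mxE => vBj.
by rewrite -[RHS]vBj; apply: eq_bigr => i _; rewrite mxE /= valK.
Qed.

Lemma exists_min_size_poly (R : nzRingType) (P : {poly R} -> Prop) (p : {poly R}) :
  p != 0 -> P p ->
  exists q : {poly R}, [/\ q != 0, P q & forall u : {poly R}, (size u < size q)%N -> P u -> u = 0].
Proof.
move=> nz_p Pp; pose S s := exists2 q : {poly R}, size q = s & q != 0 /\ P q.
have ex_s : exists s, `[< S s >] by exists (size p); apply/asboolP; exists p.
case: (ex_minnP ex_s) => s /asboolP[q size_q [nz_q Pq]] min_s; exists q; split=> // u lt_uq Pu.
apply: contraTeq lt_uq => nz_u; rewrite -leqNgt size_q.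
by apply/min_s/asboolP; exists u.
Qed.

Section DifferenceOperators.
Variable C : fieldType.
Implicit Types (p q : {poly {poly C}}) (f : nat -> C).

(* [p] stands for the operator [\sum_i p_i(n) S^i], with [S] the shift. *)
Definition diffop p f (n : nat) : C := \sum_(i < size p) (p`_i).[n%:R] * f (n + i)%N.

Lemma diffop_widen N p f n : (size p <= N)%N ->
  diffop p f n = \sum_(i < N) (p`_i).[n%:R] * f (n + i)%N.
Proof.
move=> le_pN; rewrite /diffop (big_ord_widen N (fun i => (p`_i).[n%:R] * f (n + i)%N)) //.
rewrite big_mkcond; apply: eq_bigr => i _; case: ltnP => // le_pi.
by rewrite nth_default // horner0 mul0r.
Qed.

Lemma diffop0 f n : diffop 0 f n = 0.
Proof. by rewrite /diffop size_poly0 big_ord0. Qed.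

Lemma diffop1 f n : diffop 1 f n = f n.
Proof. by rewrite /diffop size_poly1 big_ord1 coef1 hornerC mul1r addn0. Qed.

Lemma diffopD p q f n : diffop (p + q) f n = diffop p f n + diffop q f n.
Proof.
pose N := maxn (size p) (size q).
rewrite !(@diffop_widen N) ?leq_maxl ?leq_maxr ?size_polyD // -big_split /=.
by apply: eq_bigr => i _; rewrite coefD hornerD mulrDl.
Qed.

Lemma diffopCM (c : {poly C}) p f n : diffop (c%:P * p) f n = c.[n%:R] * diffop p f n.
Proof.
rewrite (@diffop_widen (size p)) ?mul_polyC ?size_scale_leq // mulr_sumr.
by apply: eq_bigr => i _; rewrite coefZ hornerM mulrA.
Qed.

Lemma diffopMX p f n : diffop (p * 'X) f n = diffop p (fun k => f k.+1) n.
Proof.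
rewrite (@diffop_widen (size p).+1); last first.
  by rewrite (leq_trans (size_polyMleq _ _)) // size_polyX addn2.
rewrite big_ord_recl coefMX horner0 mul0r add0r.
by apply: eq_bigr => i _; rewrite coefMX lift0 /= addnS.
Qed.

End DifferenceOperators.

Section RationalSpan.
Variable C : fieldType.

(* Membership of the germ at infinity of [h] in the [C(n)]-span of the germs of the [g i]. *)
Definition ratspan (I : finType) (g : I -> nat -> C) (h : nat -> C) :=
  exists2 D : {poly C}, D != 0 & exists t : I -> {poly C},
    \forall n \near \oo, D.[n%:R] * h n = \sum_i (t i).[n%:R] * g i n.

Section Closure.
Variables (I : finType) (g : I -> nat -> C).
Implicit Types (p : {poly C}) (h : nat -> C).

Lemma ratspan_gen i : ratspan g (g i).
Proof.
exists 1; rewrite ?oner_eq0 //; exists (fun j => (j == i)%:R); exists 0%N => // n _.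
rewrite (bigD1 i) //= eqxx big1 ?addr0 ?hornerE // => j /negPf->.
by rewrite horner0 mul0r.
Qed.

Lemma ratspan0 : ratspan g (fun=> 0).
Proof.
exists 1; rewrite ?oner_eq0 //; exists (fun=> 0); exists 0%N => // n _.
by rewrite mulr0 big1 // => i _; rewrite horner0 mul0r.
Qed.

Lemma ratspanD h1 h2 : ratspan g h1 -> ratspan g h2 -> ratspan g (fun n => h1 n + h2 n).
Proof.
move=> [D1 nz1 [t1 h1E]] [D2 nz2 [t2 h2E]]; exists (D1 * D2); first by rewrite mulf_neq0.
exists (fun i => D2 * t1 i + D1 * t2 i); apply: filterS2 h1E h2E => n h1E h2E.
rewrite hornerM mulrDr -mulrA mulrCA h1E -mulrA h2E !mulr_sumr -big_split /=.
by apply: eq_bigr => i _; rewrite hornerD !hornerM mulrDl !mulrA.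
Qed.

Lemma ratspanM p h : ratspan g h -> ratspan g (fun n => p.[n%:R] * h n).
Proof.
move=> [D nz_D [t hE]]; exists D => //; exists (fun i => p * t i).
apply: filterS hE => n hE; rewrite mulrCA hE mulr_sumr.
by apply: eq_bigr => i _; rewrite hornerM mulrA.
Qed.

Lemma ratspan_div p h h' : p != 0 -> (\forall n \near \oo, p.[n%:R] * h n = h' n) ->
  ratspan g h' -> ratspan g h.
Proof.
move=> nz_p eq_h [D nz_D [t hE]]; exists (p * D); rewrite ?mulf_neq0 //.
exists t; apply: filterS2 eq_h hE => n eq_h <-.
by rewrite hornerM -eq_h mulrCA mulrA.
Qed.

Lemma ratspan_near_eq h h' : (\forall n \near \oo, h n = h' n) -> ratspan g h' -> ratspan g h.
Proof.
move=> eq_h; apply: ratspan_div (oner_neq0 _) _.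
by apply: filterS eq_h => n ->; rewrite hornerC mul1r.
Qed.

Lemma ratspan_sum (J : Type) (r : seq J) (t : J -> {poly C}) (h : J -> nat -> C) :
  (forall j, ratspan g (h j)) -> ratspan g (fun n => \sum_(j <- r) (t j).[n%:R] * h j n).
Proof.
move=> g_h; elim: r => [|j r IHr].
  by apply: ratspan_near_eq ratspan0; exists 0%N => // n _; rewrite big_nil.
apply: ratspan_near_eq (ratspanD (ratspanM (t j) (g_h j)) IHr).
by exists 0%N => // n _; rewrite big_cons.
Qed.

Lemma ratspan_dependence m (h : 'I_m -> nat -> C) : (#|I| < m)%N ->
  (forall k, ratspan g (h k)) -> exists2 c : 'I_m -> {poly C}, exists k, c k != 0 &
    \forall n \near \oo, \sum_k (c k).[n%:R] * h k n = 0.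
Proof.
move=> lt_Im g_h; have /choice[D hD] k : exists D : {poly C}, D != 0 /\
    exists t, \forall n \near \oo, D.[n%:R] * h k n = \sum_i (t i : {poly C}).[n%:R] * g i n.
  by have [D ? ?] := g_h k; exists D.
have /choice[t ht] k := (hD k).2.
have [v /rV0Pn[k nz_k] vt0] := exists_left_kernel (\matrix_(k, i) t k (enum_val i)) lt_Im.
exists (fun k => v 0 k * D k); first by exists k; rewrite mulf_neq0 // (hD k).1.
apply: filterS (filter_forall _ ht) => n hE.
transitivity (\sum_k \sum_i (v 0 k * t k i).[n%:R] * g i n).
  apply: eq_bigr => l _; rewrite hornerM -mulrA hE mulr_sumr.
  by apply: eq_bigr => i _; rewrite hornerM mulrA.
rewrite exchange_big big1 //= => i _; rewrite -mulr_suml -horner_sum.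
have /rowP/(_ (enum_rank i)) := vt0; rewrite !mxE => vti.
rewrite (_ : \sum_l _ = 0) ?horner0 ?mul0r // -[RHS]vti.
by apply: eq_bigr => l _; rewrite mxE enum_rankK.
Qed.

End Closure.

Lemma ratspan_trans (I J : finType) (g : I -> nat -> C) (g' : J -> nat -> C) h :
  (forall i, ratspan g' (g i)) -> ratspan g h -> ratspan g' h.
Proof. by move=> g'_g [D nz_D [t hE]]; apply: (ratspan_div nz_D hE); apply: ratspan_sum. Qed.

Lemma ratspan_affine (I : finType) (g : I -> nat -> C) h (a b : nat) :
  (0 < a)%N -> a%:R != 0 :> C -> ratspan g h ->
  ratspan (fun i n => g i (a * n + b)%N) (fun n => h (a * n + b)%N).
Proof.
move=> a_gt0 nz_a [D nz_D [t hE]].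
exists (affine_subst a%:R b%:R D); first by rewrite affine_subst_eq0.
exists (fun i => affine_subst a%:R b%:R (t i)); apply: filterS (near_affine b a_gt0 hE) => n hnE.
by rewrite horner_affine_subst_natr hnE; apply: eq_bigr => i _; rewrite horner_affine_subst_natr.
Qed.

End RationalSpan.

Section PRecursive.
Variable C : fieldType.
Implicit Types (p q : {poly C}) (f g : nat -> C) (r : nat).

Definition precursive r f := exists P : {poly {poly C}},
  [/\ P != 0, (size P <= r.+1)%N & \forall n \near \oo, diffop P f n = 0].

Lemma precursive_of_relation r f (c : 'I_r.+1 -> {poly C}) k : c k != 0 ->
  (\forall n \near \oo, \sum_i (c i).[n%:R] * f (n + i)%N = 0) -> precursive r f.
Proof.
move=> nz_ck cf0; pose P := rVpoly (\row_i c i); exists P; split; last 1 first.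
- apply: filterS cf0 => n cf0; rewrite (diffop_widen _ _ (size_poly _ _)) -[RHS]cf0.
  by apply: eq_bigr => i _; rewrite coef_rVpoly_ord mxE.
- apply: contraNneq nz_ck => P0; have := congr1 (fun Q : {poly {poly C}} => Q`_k) P0.
  by rewrite coef_rVpoly_ord mxE coef0 => ->.
- exact: size_poly.
Qed.

Lemma precursive_ratspan r f : precursive r f ->
  exists g : 'I_r -> nat -> C, forall k, ratspan g (fun n => f (n + k)%N).
Proof.
move=> [P [nz_P le_Pr Pf0]]; exists (fun i n => f (n + i)%N) => k.
have := polySpred nz_P; set d := (size P).-1 => sizeP.
elim/ltn_ind: k => k IHk; case: (ltnP k r) => [lt_kr|le_rk].
  exact: (ratspan_gen _ (Ordinal lt_kr)).
pose m := (k - d)%N; have def_k : k = (m + d)%N by rewrite /m; lia.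
have nz_lead : shiftp m (lead_coef P) != 0 by rewrite shiftp_eq0 lead_coef_eq0.
apply: (ratspan_div nz_lead (h' := fun n =>
  \sum_(i < d) (- shiftp m P`_i).[n%:R] * f (n + (m + i))%N)); last first.
  by apply: ratspan_sum => i; apply: IHk; rewrite def_k ltn_add2l.
apply: filterS ((near_addn _ m).2 Pf0) => n.
rewrite /diffop sizeP big_ord_recr /= addrC => /eqP; rewrite addr_eq0 => /eqP.
rewrite lead_coefE sizeP horner_shiftp_natr -addnA -def_k => ->.
rewrite -sumrN; apply: eq_bigr => i _.
by rewrite hornerN horner_shiftp_natr mulNr addnA.
Qed.

Lemma ratspan_precursive (I : finType) (g : I -> nat -> C) f :
  (forall k, ratspan g (fun n => f (n + k)%N)) -> precursive #|I| f.
Proof.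
move=> g_f; have [c [k nz_ck] cf0] :=
  ratspan_dependence (h := fun (k : 'I_#|I|.+1) n => f (n + k)%N) (ltnSn _) (fun k => g_f k).
exact: precursive_of_relation nz_ck cf0.
Qed.

Lemma precursiveD r s f g :
  precursive r f -> precursive s g -> precursive (r + s) (fun n => f n + g n).
Proof.
move=> /precursive_ratspan[u u_f] /precursive_ratspan[v v_g].
have -> : (r + s = #|{: 'I_r + 'I_s}|)%N by rewrite card_sum !card_ord.
pose uv (i : 'I_r + 'I_s) := match i with inl j => u j | inr j => v j end.
apply: (@ratspan_precursive _ uv) => k.
apply: ratspanD; [apply: ratspan_trans (u_f k)|apply: ratspan_trans (v_g k)] => i.
- exact: (ratspan_gen uv (inl i)).
- exact: (ratspan_gen uv (inr i)).
Qed.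

Lemma precursive_ratfun_mul r f g p q : q != 0 ->
  (\forall n \near \oo, q.[n%:R] * g n = p.[n%:R] * f n) -> precursive r f -> precursive r g.
Proof.
move=> nz_q eq_gf /precursive_ratspan[u u_f]; rewrite -(card_ord r).
apply: (@ratspan_precursive _ u) => k; have nz_qk : shiftp k q != 0 by rewrite shiftp_eq0.
apply: (ratspan_div nz_qk _ (ratspanM (shiftp k p) (u_f k))).
by apply: filterS ((near_addn _ k).2 eq_gf) => n; rewrite !horner_shiftp_natr.
Qed.

Lemma precursiveZ r c f : precursive r f -> precursive r (fun n => c * f n).
Proof.
apply: (@precursive_ratfun_mul _ _ _ c%:P 1); rewrite ?oner_eq0 //.
by exists 0%N => // n _; rewrite !hornerC mul1r.
Qed.

Hypothesis pchar0 : has_pchar0 C.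

Lemma precursive_minimal r f : precursive r f -> ~ (\forall n \near \oo, f n = 0) ->
  exists d (Q : {poly {poly C}}),
    [/\ size Q = d.+2, \forall n \near \oo, diffop Q f n = 0 & ~ precursive d f].
Proof.
move=> [P [nz_P _ Pf0]] f_nz.
have [Q [nz_Q Qf0 min_Q]] := exists_min_size_poly (P := fun Q =>
  \forall n \near \oo, diffop Q f n = 0) nz_P Pf0.
case sizeQ : (size Q) => [|[|d]]; first by move/eqP: sizeQ; rewrite size_poly_eq0 (negPf nz_Q).
  have def_Q : Q = (Q`_0)%:P by apply: size1_polyC; rewrite sizeQ.
  have nz_Q0 : Q`_0 != 0 by apply: contraNneq nz_Q => Q0; rewrite def_Q Q0.
  case: f_nz; apply: filterS2 Qf0 (near_horner_neq0 pchar0 nz_Q0) => n.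
  rewrite {1}def_Q -[_%:P]mulr1 diffopCM diffop1 => /eqP.
  by rewrite mulf_eq0 => /orP[->//|/eqP].
exists d, Q; split=> // -[R [/eqP nz_R le_Rd Rf0]].
by apply/nz_R/min_Q; rewrite // sizeQ ltnS.
Qed.

Lemma precursive_section r f (a b : nat) : (0 < a)%N -> precursive r f ->
  precursive r (fun n => f (a * n + b)%N).
Proof.
move=> a_gt0 /precursive_ratspan[u u_f]; rewrite -(card_ord r).
apply: (@ratspan_precursive _ (fun i n => u i (a * n + b)%N)) => k.
have nz_a : a%:R != 0 :> C by rewrite pchar0_natr_eq0 // -lt0n.
apply: ratspan_near_eq (ratspan_affine b a_gt0 nz_a (u_f (a * k)%N)).
by exists 0%N => // n _; congr f; lia.
Qed.

Lemma precursive_zero_windows r f : precursive r f ->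
  (forall N, exists2 n, (N <= n)%N & forall i, (i < r)%N -> f (n + i)%N = 0) ->
  \forall n \near \oo, f n = 0.
Proof.
move=> [P [nz_P le_Pr Pf0]] windows.
have := polySpred nz_P; set d := (size P).-1 => sizeP.
have nz_lead : lead_coef P != 0 by rewrite lead_coef_eq0.
have [N _ HN] := filterI Pf0 (near_horner_neq0 pchar0 nz_lead).
have [n le_Nn f_n0] := windows N.
suff f0 j : f (n + j)%N = 0 by exists n => // k /= le_nk; rewrite -(subnKC le_nk).
elim/ltn_ind: j => j IHj; case: (ltnP j r) => [/f_n0//|le_rj].
have [/eqP + nz_n] := HN (n + (j - d))%N (leq_trans le_Nn (leq_addr _ _)).
rewrite /diffop sizeP big_ord_recr big1 /= ?add0r => [|i _]; last first.
  by rewrite -addnA IHj ?mulr0 //; have := ltn_ord i; lia.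
rewrite lead_coefE sizeP in nz_n; rewrite mulf_eq0 (negPf nz_n) => /eqP f_nj.
by rewrite -[RHS]f_nj -addnA subnK //; lia.
Qed.

End PRecursive.

Lemma precursive_map (C D : fieldType) (iota : {rmorphism C -> D}) r (f : nat -> C) :
  precursive r f -> precursive r (iota \o f).
Proof.
move=> [P [nz_P le_Pr Pf0]].
have sizeM : size (map_poly (map_poly iota) P) = size P.
  by rewrite size_map_inj_poly ?rmorph0 //; exact: map_poly_inj.
exists (map_poly (map_poly iota) P); rewrite -size_poly_eq0 sizeM size_poly_eq0; split=> //.
apply: filterS Pf0 => n Pf0; rewrite -[RHS](rmorph0 iota) -Pf0 /diffop sizeM rmorph_sum.
by apply: eq_bigr => i _; rewrite rmorphM coef_map -[n%:R in LHS](rmorph_nat iota) horner_map.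
Qed.

(** * Heights of transition matrices *)

Section MatrixHeights.
Variable F : fieldType.
Implicit Types (p q D : {poly F}) (k l r h : nat).

Definition degree_le_mx k l h (A : 'M[{poly F}]_(k, l)) :=
  forall i j, (size (A i j) <= h.+1)%N.

Lemma degree_le_mxW k l h h' (A : 'M[{poly F}]_(k, l)) :
  (h <= h')%N -> degree_le_mx h A -> degree_le_mx h' A.
Proof. by move=> le_h degA i j; apply: leq_trans (degA i j) _. Qed.

Lemma size_polyM_leq p q h h' : (size p <= h.+1)%N -> (size q <= h'.+1)%N ->
  (size (p * q)%R <= (h + h').+1)%N.
Proof. by move=> le_p le_q; apply: leq_trans (size_polyMleq _ _) _; lia. Qed.

Lemma degree_le_mulmx k l r h h' (A : 'M[{poly F}]_(k, l)) (B : 'M[{poly F}]_(l, r)) :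
  degree_le_mx h A -> degree_le_mx h' B -> degree_le_mx (h + h') (A *m B).
Proof.
move=> degA degB i j; rewrite mxE; apply: leq_trans (size_sum _ _ _) _.
by apply/bigmax_leqP => t _; apply: size_polyM_leq.
Qed.

Lemma degree_le_mx_affine_subst k l h (a b : F) (A : 'M[{poly F}]_(k, l)) : a != 0 ->
  degree_le_mx h A -> degree_le_mx h (map_mx (affine_subst a b) A).
Proof. by move=> nz_a degA i j; rewrite mxE size_affine_subst. Qed.

Lemma degree_le_mx_exists k l (A : 'M[{poly F}]_(k, l)) : exists h, degree_le_mx h A.
Proof.
exists (\max_i \max_j size (A i j))%N => i j; apply: leqW.
exact: leq_trans (leq_bigmax (F := fun j => size (A i j)) j)
  (leq_bigmax (F := fun i => \max_j size (A i j)) i).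
Qed.

Lemma scalemxI k l p (A B : 'M[{poly F}]_(k, l)) : p != 0 -> p *: A = p *: B -> A = B.
Proof.
move=> nz_p /matrixP eqAB; apply/matrixP => i j.
by have := eqAB i j; rewrite !mxE => /(mulfI nz_p).
Qed.

(* The matrix of rational functions [A / p] is a quotient [W / D] with degrees at most [h]. *)
Definition quot_height_le k l p (A : 'M[{poly F}]_(k, l)) h :=
  exists D, exists W : 'M[{poly F}]_(k, l),
    [/\ D != 0, (size D <= h.+1)%N, degree_le_mx h W & D *: A = p *: W].

Lemma quot_height_leW k l p (A : 'M[{poly F}]_(k, l)) h h' :
  (h <= h')%N -> quot_height_le p A h -> quot_height_le p A h'.
Proof.
move=> le_h [D [W [nz_D le_D degW eqDW]]]; exists D, W; split=> //.
  exact: leq_trans le_D _.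
exact: degree_le_mxW degW.
Qed.

Lemma quot_height_exists k l p (A : 'M[{poly F}]_(k, l)) :
  p != 0 -> exists h, quot_height_le p A h.
Proof.
move=> nz_p; have [h degA] := degree_le_mx_exists A; exists (size p + h)%N, p, A; split=> //.
  by rewrite leqW ?leq_addr.
by apply: degree_le_mxW degA; apply: leq_addl.
Qed.

Lemma quot_height_eq k l p p' (A A' : 'M[{poly F}]_(k, l)) h :
  p != 0 -> p *: A' = p' *: A -> quot_height_le p A h -> quot_height_le p' A' h.
Proof.
move=> nz_p eqA [D [W [nz_D le_D degW eqDW]]]; exists D, W; split=> //.
apply: (scalemxI nz_p).
transitivity (p' *: (D *: A)); last by rewrite eqDW !scalerA mulrC.
by rewrite scalerA mulrC -scalerA eqA !scalerA mulrC.
Qed.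

Lemma quot_height_mul k l r p p' (A : 'M[{poly F}]_(k, l)) (B : 'M[{poly F}]_(l, r)) h h' :
  quot_height_le p A h -> quot_height_le p' B h' -> quot_height_le (p * p') (A *m B) (h + h').
Proof.
move=> [D [W [nz_D le_D degW eqDW]]] [D' [W' [nz_D' le_D' degW' eqDW']]].
exists (D * D'), (W *m W'); split; first by rewrite mulf_neq0.
- exact: size_polyM_leq.
- exact: degree_le_mulmx.
- transitivity ((D *: A) *m (D' *: B)); first by rewrite -scalemxAl -scalemxAr scalerA.
  by rewrite eqDW eqDW' -scalemxAl -scalemxAr scalerA.
Qed.

Lemma quot_height_subst k l (a b : F) p (A : 'M[{poly F}]_(k, l)) h : a != 0 ->
  quot_height_le p A h -> quot_height_le (affine_subst a b p) (map_mx (affine_subst a b) A) h.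
Proof.
move=> nz_a [D [W [nz_D le_D degW eqDW]]].
exists (affine_subst a b D), (map_mx (affine_subst a b) W); split.
- by rewrite affine_subst_eq0.
- by rewrite size_affine_subst.
- exact: degree_le_mx_affine_subst.
- by rewrite -!map_mxZ eqDW.
Qed.

Lemma quot_height_substI k l (a b : F) p (A : 'M[{poly F}]_(k, l)) h : a != 0 ->
  quot_height_le (affine_subst a b p) (map_mx (affine_subst a b) A) h -> quot_height_le p A h.
Proof.
move=> nz_a; have nz_aV : a^-1 != 0 by rewrite invr_eq0.
move/(quot_height_subst (- (b / a)) nz_aV); rewrite affine_substK // -map_mx_comp.
by rewrite map_mx_id // => ? /=; rewrite affine_substK.
Qed.

End MatrixHeights.

Section EvaluateMatrix.
Variable F : fieldType.

Definition eval_mx k l (x : F) (A : 'M[{poly F}]_(k, l)) : 'M[F]_(k, l) :=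
  map_mx (horner_eval x) A.

Lemma eval_mxM k l r x (A : 'M[{poly F}]_(k, l)) (B : 'M[{poly F}]_(l, r)) :
  eval_mx x (A *m B) = eval_mx x A *m eval_mx x B.
Proof. exact: map_mxM. Qed.

Lemma eval_mxZ k l x p (A : 'M[{poly F}]_(k, l)) : eval_mx x (p *: A) = p.[x] *: eval_mx x A.
Proof. exact: map_mxZ. Qed.

Lemma eval_mxB k l x (A B : 'M[{poly F}]_(k, l)) : eval_mx x (A - B) = eval_mx x A - eval_mx x B.
Proof. exact: map_mxB. Qed.

Lemma eval_mx_sum k l x (I : Type) (r : seq I) (A : I -> 'M[{poly F}]_(k, l)) :
  eval_mx x (\sum_(i <- r) A i) = \sum_(i <- r) eval_mx x (A i).
Proof. exact: (raddf_sum (map_mx (horner_eval x))). Qed.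

Lemma eval_mx_affine_subst k l a b x (A : 'M[{poly F}]_(k, l)) :
  eval_mx x (map_mx (affine_subst a b) A) = eval_mx (a * x + b) A.
Proof. by apply/matrixP => i j; rewrite !mxE; exact: horner_affine_subst. Qed.

Lemma eval_mx_affine_subst_natr k l (a b n : nat) (A : 'M[{poly F}]_(k, l)) :
  eval_mx n%:R (map_mx (affine_subst a%:R b%:R) A) = eval_mx (a * n + b)%:R A.
Proof. by rewrite eval_mx_affine_subst natrD natrM. Qed.

Lemma eval_mx_shift_natr k l (m n : nat) (A : 'M[{poly F}]_(k, l)) :
  eval_mx m%:R (map_mx (shiftp n) A) = eval_mx (m + n)%:R A.
Proof. by rewrite eval_mx_affine_subst mul1r natrD. Qed.

End EvaluateMatrix.

Section TransitionMatrix.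
Variables (F : fieldType) (d : nat) (Q : {poly {poly F}}).
Hypothesis sizeQ : size Q = d.+2.

Definition companion_mx : 'M[{poly F}]_d.+1 :=
  \matrix_(i, j) if (i < d)%N then (j == i.+1 :> nat)%:R * lead_coef Q else - Q`_j.

Definition lead_prod (n : nat) : {poly F} := \prod_(0 <= i < n) shiftp i (lead_coef Q).

(* If [Q] annihilates [G], then [transition_mx n / lead_prod n] maps the window of [G] at a
   large [a] to its window at [a + n]. *)
Fixpoint transition_mx (n : nat) : 'M[{poly F}]_d.+1 :=
  if n is k.+1 then map_mx (shiftp k) companion_mx *m transition_mx k else 1%:M.

Lemma lead_coef_neq0 : lead_coef Q != 0.
Proof. by rewrite lead_coef_eq0 -size_poly_gt0 sizeQ. Qed.

Lemma lead_prod_neq0 n : lead_prod n != 0.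
Proof.
by rewrite prodf_seq_neq0; apply/allP => i _; rewrite shiftp_eq0 lead_coef_neq0.
Qed.

Lemma lead_prodS n : lead_prod n.+1 = lead_prod n * shiftp n (lead_coef Q).
Proof. exact: big_nat_recr. Qed.

Lemma lead_prodD m n : lead_prod (m + n) = lead_prod m * shiftp m (lead_prod n).
Proof.
elim: n => [|n IHn]; first by rewrite addn0 /lead_prod (@big_nil _ 1) rmorph1 mulr1.
by rewrite addnS !lead_prodS IHn rmorphM /= shiftpD mulrA.
Qed.

Lemma transition_mxD m n :
  transition_mx (m + n) = map_mx (shiftp m) (transition_mx n) *m transition_mx m.
Proof.
elim: n => [|n IHn]; first by rewrite addn0 /= map_mx1 mul1mx.
rewrite addnS /= IHn map_mxM mulmxA; congr (_ *m _ *m _).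
by apply/matrixP => i j; rewrite !mxE /= shiftpD.
Qed.

Lemma det_transition_mx n :
  \det (transition_mx n) = \prod_(0 <= i < n) shiftp i (\det companion_mx).
Proof.
elim: n => [|n IHn]; first by rewrite big_nil det1.
by rewrite big_nat_recr //= det_mulmx IHn mulrC -det_map_mx.
Qed.

Lemma transition_height0 : quot_height_le (lead_prod 0) (transition_mx 0) 0.
Proof.
exists 1, 1%:M; split; rewrite ?oner_eq0 ?size_poly1 //; last by rewrite /lead_prod big_nil.
by move=> i j; rewrite mxE; case: eqP; rewrite ?size_poly1 ?size_poly0.
Qed.

Lemma transition_height_succ : exists c, forall n h,
  quot_height_le (lead_prod n) (transition_mx n) h ->
  quot_height_le (lead_prod n.+1) (transition_mx n.+1) (h + c).
Proof.
have [c le_c] := quot_height_exists companion_mx lead_coef_neq0; exists c => n h le_h.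
by rewrite lead_prodS mulrC addnC;
  apply: quot_height_mul (quot_height_subst _ (oner_neq0 _) le_c) le_h.
Qed.

End TransitionMatrix.

Section Windows.
Variables (C : fieldType) (d : nat) (G : nat -> C) (Q : {poly {poly C}}).
Hypothesis pchar0 : has_pchar0 C.
Hypotheses (sizeQ : size Q = d.+2) (annG : \forall n \near \oo, diffop Q G n = 0).
Hypothesis min_order : ~ precursive d G.

Local Notation lead := (lead_coef Q).
Local Notation companion := (companion_mx d Q).
Local Notation Tr := (transition_mx d Q).
Local Notation Lp := (lead_prod Q).

Definition window (a : nat) : 'cV[C]_d.+1 := \col_i G (a + i)%N.

Lemma window_independent k (A : 'M[{poly C}]_(k, d.+1)) :
  (\forall a \near \oo, eval_mx a%:R A *m window a = 0) -> A = 0.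
Proof.
move=> A_window; apply: contrapT => nz_A; apply: min_order.
have {nz_A}[i [j nz_Aij]] : exists i j, A i j != 0.
  apply: contrapT => A0; apply: nz_A; apply/matrixP => i j; rewrite mxE.
  by apply/eqP; apply: contrapT => /negP nz_Aij; apply: A0; exists i, j.
apply: precursive_of_relation nz_Aij _; apply: filterS A_window => a /matrixP/(_ i 0).
by rewrite !mxE => Aa0; rewrite -[RHS]Aa0; apply: eq_bigr => t _; rewrite !mxE.
Qed.

Lemma companion_window :
  \forall a \near \oo, lead.[a%:R] *: window a.+1 = eval_mx a%:R companion *m window a.
Proof.
apply: filterS annG => a; rewrite /diffop sizeQ big_ord_recr /= => /eqP.
rewrite addrC addr_eq0 => /eqP eq_last; apply/colP => i; rewrite !mxE.
case: (ltnP i d) => [lt_id|le_di].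
  have lt_id1 : (i.+1 < d.+1)%N by [].
  rewrite (bigD1 (Ordinal lt_id1)) //= big1 ?addr0 => [|j ne_j].
    by rewrite !mxE lt_id eqxx mul1r /horner_eval addnS addSn.
  have /negPf ne_ji : (j != i.+1 :> nat) by rewrite -val_eqE in ne_j.
  by rewrite !mxE lt_id ne_ji mul0r /horner_eval horner0 mul0r.
have -> : (i : nat) = d by have := ltn_ord i; lia.
rewrite addSnnS lead_coefE sizeQ eq_last -sumrN; apply: eq_bigr => j _.
by rewrite !mxE ltnNge le_di /= /horner_eval hornerN mulNr.
Qed.

Lemma transition_window n : \forall a \near \oo,
  (Lp n).[a%:R] *: window (a + n) = eval_mx a%:R (Tr n) *m window a.
Proof.
elim: n => [|n IHn].
  exists 0%N => // a _; rewrite /lead_prod big_nil hornerE scale1r addn0 /=.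
  by rewrite /eval_mx map_mx1 mul1mx.
apply: filterS2 IHn ((near_addn _ n).2 companion_window) => a IHa comp_a.
rewrite lead_prodS hornerM horner_shiftp_natr -scalerA addnS comp_a.
by rewrite scalemxAr IHa eval_mxM eval_mx_shift_natr mulmxA.
Qed.

Lemma det_companion_neq0 : \det companion != 0.
Proof.
apply/negP => /det0P[v /negP nz_v v_comp]; apply: nz_v.
have vS0 : map_mx (affine_subst 1 (- 1)) v = 0.
  apply/window_independent/(near_addn _ 1).
  apply: filterS2 companion_window (near_horner_neq0 pchar0 (lead_coef_neq0 sizeQ)).
  move=> a comp_a nz_a; apply: (scalerI nz_a).
  rewrite scaler0 scalemxAr addn1 comp_a eval_mx_affine_subst mul1r -natr1 addrK.
  by rewrite mulmxA -eval_mxM v_comp /eval_mx map_mx0 mul0mx.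
apply/eqP/matrixP => i j; have /matrixP/(_ i j)/eqP := vS0; rewrite !mxE.
by rewrite affine_subst_eq0 ?oner_eq0 // => /eqP.
Qed.

Section Dilation.
Variables (M m : nat) (gam : C).
Hypotheses (M_gt0 : (0 < M)%N) (nz_gam : gam != 0).
Hypothesis self_similar : forall a, G (M * a + m)%N = gam * G a.

Local Notation dilate := (affine_subst M%:R m%:R).

Let nz_M : M%:R != 0 :> C. Proof. by rewrite pchar0_natr_eq0 // -lt0n. Qed.

Lemma det_neq0_recovers_window e (T : 'M[{poly C}]_d.+1) (w : nat -> 'cV[C]_d.+1) : e != 0 ->
  (\forall a \near \oo, (e.[a%:R] * gam) *: window a = eval_mx a%:R T *m w a) -> \det T != 0.
Proof.
move=> nz_e window_T; apply/negP => /det0P[v /eqP nz_v vT]; apply/nz_v/window_independent.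
apply: filterS2 window_T (near_horner_neq0 pchar0 nz_e) => a Ta nz_ea.
apply: (scalerI (mulf_neq0 nz_ea nz_gam)); rewrite scaler0 scalemxAr Ta.
by rewrite mulmxA -eval_mxM vT /eval_mx map_mx0 mul0mx.
Qed.

Lemma dilation_mx : exists e (T : 'M[{poly C}]_d.+1), [/\ e != 0, \det T != 0 &
  \forall a \near \oo, (e.[a%:R] * gam) *: window a = eval_mx a%:R T *m window (M * a + m)].
Proof.
pose e := \prod_(k < d.+1) Lp (M * k).
pose T := \matrix_(k, j) ((\prod_(i < d.+1 | i != k) Lp (M * i)) * Tr (M * k) 0 j).
have nz_e : e != 0 by apply/prodf_neq0 => k _; exact: lead_prod_neq0 sizeQ _.
have stretch : \forall a \near \oo,
    e.[a%:R] *: (\col_k G (a + M * k)%N : 'cV_d.+1) = eval_mx a%:R T *m window a.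
  apply: filterS (filter_forall _ (fun k : 'I_d.+1 => transition_window (M * k))) => a tr_a.
  apply/colP => k; have /colP/(_ 0) := tr_a k.
  rewrite !mxE addn0 => tr_ak; rewrite /e (bigD1 k) //= hornerM mulrAC tr_ak mulrC mulr_sumr.
  by apply: eq_bigr => j _; rewrite !mxE /horner_eval hornerM mulrA.
have nz_dil_e : dilate e != 0 by rewrite affine_subst_eq0.
have dil_stretch : \forall a \near \oo,
    ((dilate e).[a%:R] * gam) *: window a = eval_mx a%:R (map_mx dilate T) *m window (M * a + m).
  apply: filterS (near_affine m M_gt0 stretch) => a stretch_a.
  rewrite eval_mx_affine_subst_natr -stretch_a horner_affine_subst_natr.
  apply/colP => k; rewrite !mxE -mulrA -self_similar.
  by congr (_ * G _); lia.
exists (dilate e), (map_mx dilate T); split=> //.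
exact: det_neq0_recovers_window dil_stretch.
Qed.

Lemma dilated_window_independent k (A : 'M[{poly C}]_(k, d.+1)) :
  (\forall a \near \oo, eval_mx a%:R A *m window (M * a + m) = 0) -> A = 0.
Proof.
have [e [T [nz_e nz_detT window_T]]] := dilation_mx => A0.
apply: (scalemxI nz_detT); rewrite scaler0.
rewrite -mul_mx_scalar -mul_adj_mx mulmxA (_ : A *m \adj T = 0) ?mul0mx //.
apply: window_independent.
apply: filterS3 A0 window_T (near_horner_neq0 pchar0 nz_e) => a Aa Ta nz_ea.
apply: (scalerI (mulf_neq0 nz_ea nz_gam)); rewrite scaler0 scalemxAr Ta mulmxA -eval_mxM.
by rewrite -mulmxA mul_adj_mx mul_mx_scalar eval_mxZ -scalemxAl Aa scaler0.
Qed.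

Lemma transition_dilate e (T : 'M[{poly C}]_d.+1) n :
  (\forall a \near \oo, (e.[a%:R] * gam) *: window a = eval_mx a%:R T *m window (M * a + m)) ->
  (e * Lp n) *: (map_mx (shiftp n) T *m map_mx dilate (Tr (M * n)))
    = (dilate (Lp (M * n)) * shiftp n e) *: (Tr n *m T).
Proof.
move=> window_T; apply/eqP; rewrite -subr_eq0; apply/eqP/dilated_window_independent.
apply: filterS2 (filterI window_T ((near_addn _ n).2 window_T))
  (filterI (transition_window n) (near_affine m M_gt0 (transition_window (M * n)))).
move=> a [Ta Tan] [tr_a tr_Ma]; rewrite eval_mxB mulmxBl; apply/eqP.
rewrite subr_eq0 !eval_mxZ !eval_mxM eval_mx_shift_natr eval_mx_affine_subst_natr.
rewrite -!scalemxAl -!mulmxA -Ta -tr_Ma.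
have -> : (M * a + m + M * n = M * (a + n) + m)%N by lia.
rewrite -!scalemxAr -Tan -tr_a !scalerA !hornerM horner_affine_subst_natr horner_shiftp_natr.
by apply/eqP; congr (_ *: _); ring.
Qed.

Lemma transition_height_dilate : exists c, forall n h,
  quot_height_le (Lp n) (Tr n) h -> quot_height_le (Lp (M * n)) (Tr (M * n)) (h + c).
Proof.
have [e [T [nz_e nz_detT window_T]]] := dilation_mx.
have [c1 le_c1] := quot_height_exists (e *: \adj T) nz_detT.
have [c2 le_c2] := quot_height_exists T nz_e.
exists (c1 + c2)%N => n h le_h; apply: (quot_height_substI (b := m%:R) nz_M).
have le_c1n := quot_height_subst n%:R (oner_neq0 C) le_c1.
have le_prod := quot_height_mul (quot_height_mul le_c1n le_h) le_c2.
rewrite [(h + _)%N]addnCA addnA; apply: quot_height_eq le_prod.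
  by rewrite !mulf_neq0 ?shiftp_eq0 // (lead_prod_neq0 sizeQ).
have adjT : map_mx (shiftp n) (\adj T) *m (map_mx (shiftp n) T *m map_mx dilate (Tr (M * n)))
    = shiftp n (\det T) *: map_mx dilate (Tr (M * n)).
  by rewrite mulmxA -map_mxM mul_adj_mx map_scalar_mx mul_scalar_mx.
transitivity (map_mx (shiftp n) (\adj T) *m
    ((e * Lp n) *: (map_mx (shiftp n) T *m map_mx dilate (Tr (M * n))))).
  by rewrite -scalemxAr adjT scalerA; congr (_ *: _); ring.
by rewrite (transition_dilate _ window_T) -scalemxAr map_mxZ -!scalemxAl scalerA mulmxA.
Qed.

Lemma transition_height_log : (1 < M)%N -> exists c, forall j n,
  (n < M ^ j)%N -> quot_height_le (Lp n) (Tr n) (c * j).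
Proof.
move=> M_gt1; have [c1 succ_c1] := transition_height_succ sizeQ.
have [c2 dil_c2] := transition_height_dilate; exists (c2 + M * c1)%N.
have add_c1 r n h : quot_height_le (Lp n) (Tr n) h ->
    quot_height_le (Lp (n + r)) (Tr (n + r)) (h + r * c1).
  move=> le_h; elim: r => [|r IHr]; first by rewrite addn0 mul0n addn0.
  by rewrite addnS; apply: quot_height_leW (succ_c1 _ _ IHr); lia.
elim=> [|j IHj] n lt_n.
  move: lt_n; rewrite expn0 ltnS leqn0 muln0 => /eqP->; exact: transition_height0.
have lt_nM : (n %/ M < M ^ j)%N by rewrite ltn_divLR // -expnSr.
rewrite (divn_eq n M) mulnC; apply: quot_height_leW (add_c1 _ _ _ (dil_c2 _ _ (IHj _ lt_nM))).
by have := ltn_pmod n M_gt0; nia.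
Qed.

End Dilation.
End Windows.

(** * Recurrences with constant coefficients *)

Section ConstantCoefficients.
Variable C : fieldType.
Implicit Types (p q w : {poly C}) (u v : nat -> C).

Definition shift_op w u (n : nat) : C := diffop w^:P u n.

Lemma shift_op_widen N w u n : (size w <= N)%N ->
  shift_op w u n = \sum_(i < N) w`_i * u (n + i)%N.
Proof.
move=> le_wN; rewrite /shift_op (@diffop_widen _ N) ?size_map_polyC //.
by apply: eq_bigr => i _; rewrite coef_map hornerC.
Qed.

Lemma shift_opE w u n : shift_op w u n = \sum_(i < size w) w`_i * u (n + i)%N.
Proof. exact: shift_op_widen. Qed.

Lemma shift_op0 u n : shift_op 0 u n = 0.
Proof. by rewrite /shift_op rmorph0 diffop0. Qed.

Lemma shift_op1 u n : shift_op 1 u n = u n.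
Proof. by rewrite /shift_op rmorph1 diffop1. Qed.

Lemma shift_opD p q u n : shift_op (p + q) u n = shift_op p u n + shift_op q u n.
Proof. by rewrite /shift_op rmorphD diffopD. Qed.

Lemma shift_opCM c w u n : shift_op (c%:P * w) u n = c * shift_op w u n.
Proof. by rewrite /shift_op rmorphM /= map_polyC diffopCM hornerC. Qed.

Lemma shift_opC c u n : shift_op c%:P u n = c * u n.
Proof. by rewrite -[c%:P]mulr1 shift_opCM shift_op1. Qed.

Lemma shift_opMX w u n : shift_op (w * 'X) u n = shift_op w u n.+1.
Proof.
rewrite /shift_op rmorphM /= map_polyX diffopMX /diffop size_map_polyC.
by apply: eq_bigr => i _; rewrite coef_map !hornerC addSn.
Qed.

Lemma shift_opXn k u n : shift_op 'X^k u n = u (n + k)%N.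
Proof.
elim: k n => [|k IHk] n; first by rewrite expr0 shift_op1 addn0.
by rewrite exprSr shift_opMX IHk addSnnS.
Qed.

Lemma shift_op_XsubC c u n : shift_op ('X - c%:P) u n = u n.+1 - c * u n.
Proof. by rewrite -['X]mul1r -polyCN shift_opD shift_opMX shift_op1 shift_opC mulNr. Qed.

Lemma shift_opM p w u n : shift_op (p * w) u n = shift_op p (shift_op w u) n.
Proof.
elim/poly_ind: p n => [|p c IHp] n; first by rewrite mul0r !shift_op0.
by rewrite mulrDl !shift_opD mulrAC !shift_opMX IHp shift_opCM shift_opC.
Qed.

Lemma shift_op_comp_Xn M m w u n :
  shift_op (w \Po 'X^M) u (M * n + m)%N = shift_op w (fun a => u (M * a + m)%N) n.
Proof.
elim/poly_ind: w n => [|w c IHw] n; first by rewrite comp_poly0 !shift_op0.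
rewrite comp_poly_MXaddC !shift_opD shift_opMX mulrC shift_opM shift_opXn !shift_opC -IHw.
by congr (shift_op _ _ _ + _); lia.
Qed.

Lemma shift_op_natr_mul w u n :
  shift_op w (fun k => k%:R * u k) n = n%:R * shift_op w u n + shift_op ('X * w^`()) u n.
Proof.
elim/poly_ind: w n => [|w c IHw] n; first by rewrite deriv0 mulr0 !shift_op0 mulr0 addr0.
rewrite derivMXaddC mulrDr [_ * w]mulrC mulrA !shift_opD !shift_opMX IHw !shift_opC -natr1.
by ring.
Qed.

Definition annihilates w u := \forall n \near \oo, shift_op w u n = 0.

Lemma annihilates_near0 w u : (\forall n \near \oo, u n = 0) -> annihilates w u.
Proof.
move=> [N _ u0]; exists N => // n /= le_Nn; rewrite shift_opE big1 // => i _.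
by rewrite u0 ?mulr0 //= (leq_trans le_Nn) ?leq_addr.
Qed.

Lemma annihilates_mull p w u : annihilates w u -> annihilates (p * w) u.
Proof. by move/(annihilates_near0 p); apply: filterS => n; rewrite shift_opM. Qed.

Lemma annihilates_dvd w p u : w %| p -> annihilates w u -> annihilates p u.
Proof. by case/dvdpP=> q ->; exact: annihilates_mull. Qed.

Lemma annihilatesD w u v :
  annihilates w u -> annihilates w v -> annihilates w (fun n => u n + v n).
Proof.
apply: filterS2 => n u0 v0; rewrite -[RHS]addr0 -{1}u0 -v0 !shift_opE -big_split /=.
by apply: eq_bigr => i _; rewrite mulrDr.
Qed.

Lemma annihilatesZ w c u : annihilates w u -> annihilates w (fun n => c * u n).
Proof.
apply: filterS => n u0; rewrite -[RHS](mulr0 c) -u0 !shift_opE mulr_sumr.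
by apply: eq_bigr => i _; rewrite mulrCA.
Qed.

Lemma annihilates_addn w u k : annihilates w u -> annihilates w (fun n => u (n + k)%N).
Proof.
move/(near_addn _ k).2; apply: filterS => n; rewrite !shift_opE => u0; rewrite -[RHS]u0.
by apply: eq_bigr => i _; rewrite addnAC.
Qed.

Lemma annihilates_coprime w p u : coprimep w p -> annihilates w u -> annihilates p u ->
  \forall n \near \oo, u n = 0.
Proof.
move=> /Bezout_eq1_coprimepP[[a b] /= bezout] /(annihilates_mull a) au /(annihilates_mull b).
by apply: filterS2 au => n au bu; rewrite -[u n]shift_op1 -bezout shift_opD au bu addr0.
Qed.

Lemma annihilator_generator w u : w != 0 -> annihilates w u ->
  exists2 mu, mu != 0 & forall p, annihilates p u <-> mu %| p.
Proof.
move=> nz_w wu; have [mu [nz_mu mu_u min_mu]] :=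
  exists_min_size_poly (P := fun p => annihilates p u) nz_w wu.
exists mu => // p; split=> [pu|/annihilates_dvd]; last exact.
rewrite /dvdp; apply/eqP/min_mu; first by rewrite ltn_modp.
have -> : p %% mu = p + (- (p %/ mu)) * mu by rewrite {2}(divp_eq p mu) mulNr addrC addKr.
apply: filterS2 pu (annihilates_mull (- (p %/ mu)) mu_u) => n p0 mu0.
by rewrite shift_opD p0 mu0 addr0.
Qed.

Definition power_annihilates w u := exists k, annihilates (w ^+ k) u.

Lemma annihilates_power w u : annihilates w u -> power_annihilates w u.
Proof. by exists 1%N; rewrite expr1. Qed.

Lemma power_annihilates_near0 w u : (\forall n \near \oo, u n = 0) -> power_annihilates w u.
Proof. by move=> u0; exists 0%N; exact: annihilates_near0. Qed.

Lemma power_annihilatesD w u v :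
  power_annihilates w u -> power_annihilates w v -> power_annihilates w (fun n => u n + v n).
Proof.
move=> [k wu] [l wv]; exists (k + l)%N.
apply: annihilatesD; [apply: annihilates_dvd wu|apply: annihilates_dvd wv].
  by apply: dvdp_exp2l; rewrite leq_addr.
by apply: dvdp_exp2l; rewrite leq_addl.
Qed.

Lemma power_annihilates_natr_mul w u :
  power_annihilates w u -> power_annihilates w (fun n => n%:R * u n).
Proof.
move=> [k wu]; exists k.+1.
have deriv_u : annihilates ('X * (w ^+ k.+1)^`()) u.
  by apply: annihilates_dvd wu; rewrite deriv_exp -mulrnAl mulrA dvdp_mulIr.
apply: filterS2 (annihilates_dvd (dvdp_exp2l _ (leqnSn k)) wu) deriv_u => n u0 du0.
by rewrite shift_op_natr_mul u0 du0 mulr0 addr0.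
Qed.

Lemma power_annihilates_horner_mul w u p :
  power_annihilates w u -> power_annihilates w (fun n => p.[n%:R] * u n).
Proof.
move=> wu; elim/poly_ind: p => [|p c IHp].
  by apply: power_annihilates_near0; exists 0%N => // n _; rewrite horner0 mul0r.
have -> : (fun n => (p * 'X + c%:P).[n%:R] * u n) =
    (fun n => n%:R * (p.[n%:R] * u n) + c * u n).
  by apply/funext => n; rewrite hornerMXaddC; ring.
apply: power_annihilatesD; first exact: power_annihilates_natr_mul.
by case: wu => k wu; exists k; exact: annihilatesZ.
Qed.

Lemma power_annihilates_addn w u k :
  power_annihilates w u -> power_annihilates w (fun n => u (n + k)%N).
Proof. by move=> [l wu]; exists l; exact: annihilates_addn. Qed.

Lemma power_annihilates_sum w (J : Type) (r : seq J) (u : J -> nat -> C) :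
  (forall j, power_annihilates w (u j)) ->
  power_annihilates w (fun n => \sum_(j <- r) u j n).
Proof.
move=> wu; elim: r => [|j r IHr].
  by apply: power_annihilates_near0; exists 0%N => // n _; rewrite big_nil.
have -> : (fun n => \sum_(i <- j :: r) u i n) = fun n => u j n + \sum_(i <- r) u i n.
  by apply/funext => n; rewrite big_cons.
exact: power_annihilatesD.
Qed.

Lemma power_annihilates_shift_op w p q u : p != 0 ->
  power_annihilates w (fun n => p.[n%:R] * u n) ->
  exists2 p', p' != 0 & power_annihilates w (fun n => p'.[n%:R] * shift_op q u n).
Proof.
move=> nz_p wpu; exists (\prod_(i < size q) shiftp i p).
  by apply/prodf_neq0 => i _; rewrite shiftp_eq0.
pose cofactor (i : 'I_(size q)) := q`_i *: \prod_(j < size q | j != i) shiftp j p.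
have -> : (fun n => (\prod_(i < size q) shiftp i p).[n%:R] * shift_op q u n) =
    fun n => \sum_i (cofactor i).[n%:R] * (p.[(n + i)%:R] * u (n + i)%N).
  apply/funext => n; rewrite shift_opE mulr_sumr; apply: eq_bigr => i _.
  by rewrite (bigD1 i) //= hornerM hornerZ horner_shiftp_natr; ring.
apply: power_annihilates_sum => i; apply: power_annihilates_horner_mul.
exact: power_annihilates_addn i wpu.
Qed.

Section Characteristic0.
Hypothesis pchar0 : has_pchar0 C.

Lemma annihilator_root w p u mu lam : p != 0 -> mu != 0 ->
  (forall q, annihilates q u <-> mu %| q) ->
  power_annihilates w (fun n => p.[n%:R] * u n) -> root mu lam -> root w lam.
Proof.
move=> nz_p nz_mu mu_gen wpu /factor_theorem[mu' def_mu].
have nz_mu' : mu' != 0 by apply: contraNneq nz_mu => mu'0; rewrite def_mu mu'0 mul0r.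
have [p' nz_p' [k w_k]] := power_annihilates_shift_op mu' nz_p wpu.
have [j lam_j] : power_annihilates ('X - lam%:P) (fun n => p'.[n%:R] * shift_op mu' u n).
  apply/power_annihilates_horner_mul/annihilates_power.
  have := (mu_gen mu).2 (dvdpp _).
  by apply: filterS => n; rewrite {1}def_mu mulrC shift_opM.
apply: contraT => nroot; have cop : coprimep (('X - lam%:P) ^+ j) (w ^+ k).
  by apply/coprimep_expl/coprimep_expr; rewrite coprimep_sym coprimep_XsubC.
have : annihilates mu' u.
  apply: filterS2 (annihilates_coprime cop lam_j w_k) (near_horner_neq0 pchar0 nz_p').
  by move=> n /eqP; rewrite mulf_eq0 => /orP[->//|/eqP].
move/mu_gen/(dvdp_leq nz_mu'); rewrite def_mu size_Mmonic ?monicXsubC // size_XsubC addn2.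
by rewrite ltnn.
Qed.

Lemma annihilator_root_neq0 u mu lam : mu != 0 ->
  (forall q, annihilates q u <-> mu %| q) -> root mu lam -> lam != 0.
Proof.
move=> nz_mu mu_gen root_lam; apply: contraTneq root_lam => ->.
apply/negP => /factor_theorem[mu' def_mu]; rewrite subr0 in def_mu.
have nz_mu' : mu' != 0 by apply: contraNneq nz_mu => mu'0; rewrite def_mu mu'0 mul0r.
have : annihilates mu' u.
  apply/(near_addn _ 1); apply: filterS ((mu_gen mu).2 (dvdpp _)) => n.
  by rewrite {1}def_mu shift_opMX addn1.
by move/mu_gen/(dvdp_leq nz_mu'); rewrite def_mu size_mulX // ltnn.
Qed.

Lemma size_shift_monomial_sub k (c : C) : exists2 T : {poly C}, (size T <= k)%N &
  shiftp 1 (c *: 'X^(k.+1)) - c *: 'X^(k.+1) = (c * k.+1%:R) *: 'X^k + T.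
Proof.
exists (c *: \sum_(i < k) 'X^(k.+1 - i.+2) *+ 'C(k.+1, i.+2)).
  apply: leq_trans (size_scale_leq _ _) _; apply: leq_trans (size_sum _ _ _) _.
  apply/bigmax_leqP => i _; rewrite -scaler_nat; apply: leq_trans (size_scale_leq _ _) _.
  by rewrite size_polyXn; have := ltn_ord i; lia.
rewrite -scalerA -scalerDr /affine_subst comp_polyZ comp_Xn_poly -scalerBr scale1r.
congr (_ *: _); rewrite exprDn !big_ord_recl !subn0 expr1n mulr1 bin0 mulr1n.
rewrite [_ + (_ + _)]addrC addrK subSS subn0 expr1n mulr1 bin1 -scaler_nat; congr (_ + _).
by apply: eq_bigr => i _; rewrite expr1n mulr1.
Qed.

Lemma antidifference p : exists s, shiftp 1 s - s = p.
Proof.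
have [n] := ubnP (size p); elim: n p => // n IHn p lt_pn.
have [->|nz_p] := eqVneq p 0; first by exists 0; rewrite raddf0 subrr.
pose k := (size p).-1; have size_p : size p = k.+1 := polySpred nz_p.
have [T le_T monomial_sub] := size_shift_monomial_sub k (lead_coef p / k.+1%:R).
set s0 := _ *: 'X^(k.+1) in monomial_sub.
have lt_rest : (size (p - (shiftp 1 s0 - s0))%R < n)%N.
  rewrite -ltnS (leq_trans _ lt_pn) // size_p !ltnS; apply/leq_sizeP => j le_kj.
  rewrite monomial_sub divfK ?pchar0_natr_eq0 // coefB coefD coefZ coefXn.
  rewrite [T`_j]nth_default ?(leq_trans le_T) // addr0.
  have [->|ne_jk] := eqVneq j k; first by rewrite mulr1 /lead_coef subrr.
  by rewrite mulr0 subr0 nth_default // size_p ltn_neqAle eq_sym ne_jk.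
have [s1 def_s1] := IHn _ lt_rest.
by exists (s1 + s0); rewrite rmorphD opprD addrACA def_s1 subrK.
Qed.

Lemma annihilates_unipotent u e : annihilates (('X - 1) ^+ e) u ->
  exists p : {poly C}, \forall n \near \oo, u n = p.[n%:R].
Proof.
elim: e u => [|e IHe] u ann_u.
  by exists 0; apply: filterS ann_u => n; rewrite shift_op1 horner0.
have [|p [N _ diff_u]] := IHe (shift_op ('X - 1) u).
  by apply: filterS ann_u => n; rewrite exprSr shift_opM.
have [s def_s] := antidifference p.
exists (s + (u N - s.[N%:R])%:P); exists N => // n /= le_Nn.
rewrite -(subnKC le_Nn); elim: (n - N)%N => [|k IHk].
  by rewrite addn0 hornerD hornerC addrC subrK.
have := diff_u (N + k)%N (leq_addr _ _); rewrite shift_op_XsubC mul1r => /(canRL (subrK _)).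
rewrite addnS => ->; rewrite IHk -def_s !hornerD !hornerC hornerN horner_shiftp_natr addn1.
by rewrite addrA subrK.
Qed.

End Characteristic0.
End ConstantCoefficients.

(** * Self-similar P-recursive sequences *)

Lemma coprimep_prodr (F : fieldType) (I : Type) (r : seq I) (P : pred I) (p : {poly F}) q :
  (forall i, P i -> coprimep p (q i)) -> coprimep p (\prod_(i <- r | P i) q i).
Proof.
by move=> cop; elim/big_rec: _ => [|i x Pi cop_x]; rewrite ?coprimep1 // coprimepMr cop.
Qed.

Lemma closed_field_roots (C : closedFieldType) (p : {poly C}) : p != 0 ->
  exists2 rs : seq C, p %= \prod_(z <- rs) ('X - z%:P) & forall z, root p z = (z \in rs).
Proof.
move=> nz_p; have [rs def_p] := closed_field_poly_normal p.
have eqp_p : p %= \prod_(z <- rs) ('X - z%:P) by rewrite {1}def_p eqp_scale ?lead_coef_eq0.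
by exists rs => // z; rewrite (eqp_root eqp_p) root_prod_XsubC.
Qed.

Section CoprimeShifts.
Variable C : closedFieldType.
Hypothesis pchar0 : has_pchar0 C.
Implicit Types p q : {poly C}.

Lemma coprimep_shift_off_seq p q : p != 0 -> q != 0 ->
  exists2 B : seq C, size B = ((size p).-1 * (size q).-1)%N &
    forall i : nat, i%:R \notin B -> coprimep p (shiftp i q).
Proof.
move=> nz_p nz_q; have [rp eqp_p rootp] := closed_field_roots nz_p.
have [rq eqp_q rootq] := closed_field_roots nz_q.
have [size_rp size_rq] : size rp = (size p).-1 /\ size rq = (size q).-1.
  by rewrite (eqp_size eqp_p) (eqp_size eqp_q) !size_prod_XsubC.
exists [seq y - x | x <- rp, y <- rq]; rewrite ?size_allpairs ?size_rp ?size_rq // => i.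
move=> i_notin; apply: Pdiv.ClosedField.root_coprimep => x root_px.
apply: contra i_notin; rewrite horner_affine_subst mul1r => root_qxi.
apply/allpairsP; exists (x, x + i%:R); rewrite /= -rootp -rootq.
by split=> //; rewrite addrAC subrr add0r.
Qed.

Lemma coprimep_far_shifts q : q != 0 ->
  exists s, forall i j, (i + s <= j)%N -> coprimep (shiftp i q) (shiftp j q).
Proof.
move=> nz_q; have [B _ off_B] := coprimep_shift_off_seq nz_q nz_q.
have nz_prod : \prod_(b <- B) ('X - b%:P) != 0 by apply/monic_neq0/monic_prod_XsubC.
have [s _ s_off_B] := near_horner_neq0 pchar0 nz_prod.
exists s => i j le_isj; rewrite -(subnKC (leq_trans (leq_addr s i) le_isj)) -shiftpD.
rewrite coprimep_shiftp off_B // -root_prod_XsubC rootE s_off_B //=.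
by rewrite leq_subRL // (leq_trans (leq_addr s i)).
Qed.

Lemma coprimep_shift_block p q (L K : nat) : p != 0 -> q != 0 ->
  ((size p).-1 * (size q).-1 <= K)%N -> exists2 k, (k <= K)%N &
    forall i, (k * L <= i < k.+1 * L)%N -> coprimep p (shiftp i q).
Proof.
move=> nz_p nz_q le_K; have [B size_B off_B] := coprimep_shift_off_seq nz_p nz_q.
apply: contrapT => no_block.
have /choice[b b_block] (k : 'I_K.+1) : exists i, (k * L <= i < k.+1 * L)%N /\ i%:R \in B.
  apply: contrapT => no_b; apply: no_block; exists k; first by rewrite -ltnS.
  by move=> i i_block; apply: off_B; apply/negP => iB; apply: no_b; exists i.
have b_div k : (b k %/ L)%N = k.
  have [/andP[le_kb lt_bk] _] := b_block k.
  have L_gt0 : (0 < L)%N by case: L le_kb lt_bk {b_block no_block} => //; lia.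
  by apply/eqP; rewrite eqn_leq leq_divRL // le_kb andbT -ltnS ltn_divLR.
have : (size [seq (b k)%:R : C | k <- enum 'I_K.+1] <= size B)%N.
  apply: uniq_leq_size => [|x /mapP[k _ ->]]; last by have [] := b_block k.
  rewrite map_inj_uniq ?enum_uniq // => k k' /(pchar0_natr_inj pchar0) eq_b.
  by apply: val_inj; rewrite /= -b_div eq_b b_div.
by rewrite size_map size_enum_ord size_B ltnNge le_K.
Qed.

End CoprimeShifts.

Lemma exists_expn_gt_linear (M a b : nat) : (1 < M)%N -> exists j, (a * j + b < M ^ j)%N.
Proof.
move=> M_gt1; pose k := (2 * a + b + 1)%N; exists (2 * k)%N.
have lt_k : (k < M ^ k)%N by exact: ltn_expl.
have : (k * k < M ^ (2 * k))%N by rewrite mul2n -addnn expnD; nia.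
by rewrite /k; nia.
Qed.

Section Poles.
Variables (C : closedFieldType) (d : nat) (Q : {poly {poly C}}).
Hypothesis pchar0 : has_pchar0 C.
Hypothesis sizeQ : size Q = d.+2.

Local Notation lead := (lead_coef Q).
Local Notation det_comp := (\det (companion_mx d Q)).
Local Notation pole := (lead * det_comp).
Local Notation Tr := (transition_mx d Q).
Local Notation Lp := (lead_prod Q).

Definition middle_prod s L : {poly C} := \prod_(s <= k < L - s) shiftp k lead.

Lemma middle_prod_neq0 s L : middle_prod s L != 0.
Proof.
by rewrite prodf_seq_neq0; apply/allP => k _; rewrite shiftp_eq0 (lead_coef_neq0 sizeQ).
Qed.

Lemma lead_prod_split s L : (s + s <= L)%N ->
  Lp L = Lp s * middle_prod s L * shiftp (L - s) (Lp s).
Proof.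
move=> le_sL; have le_s : (s <= L - s)%N by lia.
have -> : Lp L = Lp (L - s) * shiftp (L - s) (Lp s) by rewrite -lead_prodD subnK //; lia.
by congr (_ * _); rewrite /lead_prod (@big_cat_nat _ _ _ s).
Qed.

Lemma window_factor (G : nat -> C) s L (V : 'M[{poly C}]_d.+1) :
  (\forall n \near \oo, diffop Q G n = 0) -> (s + s <= L)%N -> Tr L = middle_prod s L *: V ->
  \forall a \near \oo, ((Lp s).[a%:R] * (Lp s).[(a + (L - s))%:R]) *: window d G (a + L)
    = eval_mx a%:R V *m window d G a.
Proof.
move=> annG le_sL trE.
apply: filterS2 (transition_window sizeQ annG L) (near_horner_neq0 pchar0 (middle_prod_neq0 s L)).
move=> a; rewrite (lead_prod_split le_sL) trE eval_mxZ -scalemxAl !hornerM horner_shiftp_natr.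
move=> eq_window nz_mid; apply: (scalerI nz_mid); rewrite -eq_window scalerA.
by congr (_ *: _); ring.
Qed.

Lemma annihilates_of_window_dependence (G : nat -> C) s N (V : 'I_N -> 'M[{poly C}]_d.+1)
    (v : 'rV[C]_N) (p : {poly C}) :
  (\forall n \near \oo, diffop Q G n = 0) ->
  (forall k : 'I_N, Tr (s + s + k) = middle_prod s (s + s + k) *: V k) ->
  shiftp s p = Lp s -> \sum_k (v 0 k)%:P *: row 0 (V k) = 0 ->
  annihilates (rVpoly v) (fun n => p.[n%:R] * G n).
Proof.
move=> annG trE def_p v_dep; apply/(near_addn _ (s + s)).
have window_V : \forall a \near \oo, forall k : 'I_N,
    (Lp s).[a%:R] * (p.[(a + (s + s) + k)%:R] * G (a + (s + s) + k)%N)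
      = (eval_mx a%:R (row 0 (V k)) *m window d G a) 0 0.
  apply: filter_forall => k.
  apply: filterS (window_factor annG (leq_addr k (s + s)) (trE k)) => a.
  rewrite /eval_mx map_row -row_mul mxE => <-; rewrite !mxE mulrA addn0 -addnA.
  rewrite -[X in _ = _ * X.[_] * _]def_p horner_shiftp_natr -[(a + _ + s)%N]addnA.
  by rewrite subnK // -addnA leq_addr.
apply: filterS2 window_V (near_horner_neq0 pchar0 (lead_prod_neq0 sizeQ s)) => a Va nz_a.
rewrite (@shift_op_widen _ N) ?size_poly //; apply: (mulfI nz_a); rewrite mulr0 mulr_sumr.
transitivity ((eval_mx a%:R (\sum_k (v 0 k)%:P *: row 0 (V k)) *m window d G a) 0 0).
  rewrite eval_mx_sum mulmx_suml summxE; apply: eq_bigr => k _.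
  by rewrite coef_rVpoly_ord mulrCA Va eval_mxZ hornerC -scalemxAl [RHS]mxE.
by rewrite v_dep /eval_mx map_mx0 mul0mx mxE.
Qed.

Hypothesis nz_det : det_comp != 0.

Lemma pole_neq0 : pole != 0.
Proof. by rewrite mulf_neq0 // (lead_coef_neq0 sizeQ). Qed.

(* Inverting the outer blocks of a product of three: the poles of the middle block cancel, up to
   the denominator [D] of the product and the determinants of the outer blocks. *)
Lemma shift_lead_prod_dvd (D : {poly C}) (W : 'M[{poly C}]_d.+1) a L r i j :
  D *: Tr (a + L + r) = Lp (a + L + r) *: W ->
  shiftp a (Lp L) %| D * shiftp (a + L) (\det (Tr r)) * \det (Tr a) * shiftp a (Tr L i j).
Proof.
move=> eqDW; pose X := map_mx (shiftp (a + L)) (Tr r).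
have trE : Tr (a + L + r) = X *m map_mx (shiftp a) (Tr L) *m Tr a.
  by rewrite [in LHS]transition_mxD transition_mxD mulmxA.
have -> : D * shiftp (a + L) (\det (Tr r)) * \det (Tr a) * shiftp a (Tr L i j)
    = Lp (a + L + r) * (\adj X *m W *m \adj (Tr a)) i j.
  rewrite -[shiftp _ (\det _)]det_map_mx -/X.
  have /(congr1 (fun A => (\adj X *m A *m \adj (Tr a)) i j)) := eqDW.
  rewrite trE -!scalemxAr -!scalemxAl mxE [RHS]mxE => <-.
  rewrite !mulmxA mul_adj_mx mul_scalar_mx -!scalemxAl -mulmxA mul_mx_adj mul_mx_scalar.
  by rewrite !mxE /= -!mulrA; congr (_ * (_ * _)); rewrite mulrC.
by rewrite !lead_prodD -!mulrA dvdp_mull // dvdp_mulr.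
Qed.

Lemma coprimep_middle_prod s a L r (D : {poly C}) :
  (forall i j, (i + s <= j)%N -> coprimep (shiftp i pole) (shiftp j pole)) ->
  (forall i, (a <= i < a + L)%N -> coprimep D (shiftp i pole)) ->
  coprimep (shiftp a (middle_prod s L)) (D * shiftp (a + L) (\det (Tr r)) * \det (Tr a)).
Proof.
move=> far block; have lead_pole k : shiftp k lead %| shiftp k pole.
  by rewrite rmorphM /= dvdp_mulr.
have det_pole k : shiftp k det_comp %| shiftp k pole by rewrite rmorphM /= dvdp_mull.
rewrite coprimep_sym /middle_prod rmorph_prod big_seq_cond.
apply: coprimep_prodr => k; rewrite andbT mem_index_iota => /andP[le_sk lt_kL] /=.
rewrite shiftpD !coprimepMl -andbA; apply/and3P; split.
- by apply: coprimep_dvdl (lead_pole _) (block _ _); lia.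
- rewrite det_transition_mx rmorph_prod coprimep_sym; apply: coprimep_prodr => v _ /=.
  apply: coprimep_dvdr (lead_pole _) _; rewrite shiftpD.
  by apply: coprimep_dvdl (det_pole _) (far _ _ _); lia.
rewrite det_transition_mx coprimep_sym big_seq_cond; apply: coprimep_prodr => v.
rewrite andbT mem_index_iota => /andP[_ lt_va]; rewrite coprimep_sym.
apply: coprimep_dvdr (det_pole _) (coprimep_dvdl (lead_pole _) (far _ _ _)).
by lia.
Qed.

Variables (M c : nat).
Hypothesis M_gt1 : (1 < M)%N.
Hypothesis height_log : forall j n, (n < M ^ j)%N -> quot_height_le (Lp n) (Tr n) (c * j).

(* A transition matrix of logarithmic height has no room for the poles of all the blocks of
   length [L] it consists of, so these poles cancel within some block. *)
Lemma middle_prod_dvd : exists s, forall L i j, middle_prod s L %| Tr L i j.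
Proof.
have [s far] := coprimep_far_shifts pchar0 pole_neq0; exists s => L i j.
have [t lt_t] := exists_expn_gt_linear (c * (size pole).-1 * L) L M_gt1.
pose K := (c * t * (size pole).-1)%N; pose n := (K.+1 * L)%N.
have lt_n : (n < M ^ t)%N.
  apply: leq_trans lt_t; rewrite ltnS /n /K mulSn addnC leq_add2r.
  by move: (size pole).-1 => z; rewrite (mulnAC c t z) (mulnAC (c * z) t L).
have [D [W [nz_D le_D _ eqDW]]] := height_log lt_n.
have [k le_kK block] : exists2 k, (k <= K)%N &
    forall i, (k * L <= i < k.+1 * L)%N -> coprimep D (shiftp i pole).
  apply: coprimep_shift_block => //; first exact: pole_neq0.
  by rewrite /K leq_mul //; case: (size D) le_D.
pose a := (k * L)%N; pose r := (n - (a + L))%N.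
have def_n : n = (a + L + r)%N.
  by rewrite /r subnKC // /a /n addnC -mulSn leq_mul2r ltnS le_kK orbT.
rewrite def_n in eqDW; rewrite -(@dvdp_affine_subst _ 1 a%:R) ?oner_eq0 //.
have block_a l : (a <= l < a + L)%N -> coprimep D (shiftp l pole).
  by rewrite /a [(_ + L)%N]addnC -mulSn; exact: block.
rewrite -(Gauss_dvdpr _ (coprimep_middle_prod r far block_a)).
apply: dvdp_trans (shift_lead_prod_dvd i j eqDW).
case: (leqP (s + s) L) => [le_sL|lt_Ls].
  by rewrite dvdp_affine_subst ?oner_eq0 // (lead_prod_split le_sL) -mulrA dvdp_mull // dvdp_mulr.
by rewrite /middle_prod big_geq ?rmorph1 ?dvd1p //; lia.
Qed.

Lemma transition_mx_factor : exists s, forall t L, (s + s <= L)%N -> (L < M ^ t)%N ->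
  exists2 V : 'M[{poly C}]_d.+1, Tr L = middle_prod s L *: V &
    degree_le_mx (size (Lp s) + size (Lp s) + c * t) V.
Proof.
have [s mid_dvd] := middle_prod_dvd; exists s => t L le_sL lt_L.
pose V : 'M_d.+1 := \matrix_(i, j) (Tr L i j %/ middle_prod s L).
have trE : Tr L = middle_prod s L *: V.
  by apply/matrixP => i j; rewrite !mxE mulrC divpK //; exact: mid_dvd.
exists V => // i j; have [D [W [nz_D le_D degW eqDW]]] := height_log lt_L.
have DV : D * V i j = Lp s * shiftp (L - s) (Lp s) * W i j.
  apply: (mulfI (middle_prod_neq0 s L)); have /matrixP/(_ i j) := eqDW.
  rewrite trE (lead_prod_split le_sL) !mxE => DVij; rewrite mulrCA DVij; ring.
have [->|nz_V] := eqVneq (V i j) 0; first by rewrite size_poly0.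
have : (size (V i j) <= size (D * V i j)%R)%N.
  by rewrite dvdp_leq ?mulf_neq0 // dvdp_mull.
move/leq_trans; apply; rewrite DV; apply: size_polyM_leq => //.
by apply: size_polyM_leq; rewrite ?size_shiftp.
Qed.

End Poles.

Lemma exists_scalar_dependence (F : fieldType) (N l h : nat) (V : 'I_N -> 'rV[{poly F}]_l) :
  (l * h.+1 < N)%N -> (forall k, degree_le_mx h (V k)) ->
  exists2 v : 'rV[F]_N, v != 0 & \sum_k (v 0 k)%:P *: V k = 0.
Proof.
move=> lt_N degV; pose coefs (k : 'I_N) := mxvec (\matrix_(i < l, u < h.+1) (V k 0 i)`_u).
have [v nz_v v_coefs] := exists_left_kernel (\matrix_k coefs k) lt_N.
exists v => //; apply/rowP => i; rewrite summxE mxE; apply/polyP => u; rewrite coef0 coef_sum.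
case: (ltnP u h.+1) => [lt_u|le_u].
  have /rowP/(_ (mxvec_index i (Ordinal lt_u))) := v_coefs; rewrite !mxE => v_iu.
  rewrite -[RHS]v_iu; apply: eq_bigr => k _.
  by rewrite !mxE coefCM mxvecE mxE.
rewrite big1 // => k _; rewrite mxE coefCM nth_default ?mulr0 //.
exact: leq_trans (degV k 0 i) le_u.
Qed.

Theorem self_similar_recurrence (C : closedFieldType) (pchar0 : has_pchar0 C)
    (G : nat -> C) (r M m : nat) (gam : C) :
  precursive r G -> ~ (\forall n \near \oo, G n = 0) ->
  (1 < M)%N -> gam != 0 -> (forall a, G (M * a + m)%N = gam * G a) ->
  exists2 p : {poly C}, p != 0 &
    exists2 w, w != 0 & annihilates w (fun n => p.[n%:R] * G n).
Proof.
move=> G_rec G_nz M_gt1 nz_gam self_similar.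
have [d [Q [sizeQ annG min_order]]] := precursive_minimal pchar0 G_rec G_nz.
have nz_det := det_companion_neq0 pchar0 sizeQ annG min_order.
have [c height_log] :=
  transition_height_log pchar0 sizeQ annG min_order (ltnW M_gt1) nz_gam self_similar M_gt1.
have [s factor] := transition_mx_factor pchar0 sizeQ nz_det M_gt1 height_log.
pose Lp := lead_prod Q s; pose b := (size Lp + size Lp)%N.
have [t lt_t] := exists_expn_gt_linear (d.+1 * c) (d.+1 * b.+1 + s + s) M_gt1.
pose h := (b + c * t)%N; pose N := (M ^ t - (s + s))%N.
have lt_N : (d.+1 * h.+1 < N)%N by rewrite /N /h -addSn mulnDr mulnA ltn_subRL; lia.
have /choice[V VE] (k : 'I_N) : exists V : 'M[{poly C}]_d.+1,
    transition_mx d Q (s + s + k) = middle_prod Q s (s + s + k) *: V /\ degree_le_mx h V.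
  have [||V trE degV] := factor t (s + s + k)%N; [exact: leq_addr| |by exists V].
  by have := ltn_ord k; rewrite /N; lia.
have degV k : degree_le_mx h (row 0 (V k)) by move=> i j; rewrite mxE; apply: (VE k).2.
have [v nz_v v_dep] := exists_scalar_dependence lt_N degV.
have [p def_p] := shiftp_surj s Lp; exists p.
  by rewrite -(shiftp_eq0 s) def_p (lead_prod_neq0 sizeQ).
exists (rVpoly v); first by apply: contraNneq nz_v => v0; rewrite -[v]rVpolyK v0 raddf0.
exact: (annihilates_of_window_dependence pchar0 sizeQ annG (fun k => (VE k).1) def_p v_dep).
Qed.

Lemma roots_of_unity_of_pow_surj (F : fieldType) (rs : seq F) (M : nat) :
  (1 < M)%N -> 0 \notin rs ->
  (forall z, z \in rs -> exists2 y, y \in rs & z = y ^+ M) ->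
  exists2 R, (0 < R)%N & forall z, z \in rs -> z ^+ R = 1.
Proof.
move=> M_gt1 rs0 surj.
have /choice[f fE] (z : seq_sub rs) : exists y : seq_sub rs, val z = val y ^+ M.
  by have [y y_rs ->] := surj _ (valP z); exists (SeqSub y_rs).
have f_inj : injective f by move=> y z eq_f; apply: val_inj; rewrite fE eq_f -fE.
have iter_f k z : val z = val (iter k f z) ^+ (M ^ k).
  by elim: k => [|k IHk]; rewrite ?expr1 // {1}IHk (fE (iter k f z)) -exprM expnS.
pose k := (#|{: seq_sub rs}|)`!%N.
have iter_k z : iter k f z = z.
  have /dvdnP[j ->] : (order f z %| k)%N by rewrite dvdn_fact // order_gt0 max_card.
  by rewrite iterM iter_fix // iter_order.
have Mk_gt1 : (1 < M ^ k)%N by rewrite -(expn0 M) ltn_exp2l // fact_gt0.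
exists (M ^ k).-1 => [|z z_rs]; first by rewrite -subn1 subn_gt0.
have nz_z : z != 0 by apply: contraNneq rs0 => <-.
apply: (mulfI nz_z); rewrite mulr1 -exprS prednK ?(ltnW Mk_gt1) //.
by have := iter_f k (SeqSub z_rs); rewrite iter_k.
Qed.

Section QuasiPolynomial.
Variables (C : closedFieldType) (G : nat -> C) (M m : nat) (gam : C) (p : {poly C}).
Hypotheses (pchar0 : has_pchar0 C) (M_gt1 : (1 < M)%N) (nz_gam : gam != 0) (nz_p : p != 0).
Hypothesis self_similar : forall a, G (M * a + m)%N = gam * G a.

Local Notation pG := (fun n => p.[n%:R] * G n).

Lemma self_similar_power_annihilates w : annihilates (w \Po 'X^M) pG ->
  power_annihilates w (fun n => (gam *: affine_subst M%:R m%:R p).[n%:R] * (p.[n%:R] * G n)).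
Proof.
move=> w_pG.
have -> : (fun n => (gam *: affine_subst M%:R m%:R p).[n%:R] * (p.[n%:R] * G n)) =
    (fun n => p.[n%:R] * pG (M * n + m)%N).
  by apply/funext => n; rewrite hornerZ horner_affine_subst_natr self_similar; ring.
apply/power_annihilates_horner_mul/annihilates_power.
apply: filterS (near_affine m (ltnW M_gt1) w_pG) => n.
by rewrite (shift_op_comp_Xn M m w pG).
Qed.

Lemma self_similar_annihilator_pow_surj mu lam : mu != 0 ->
  (forall q, annihilates q pG <-> mu %| q) -> root mu lam ->
  exists2 z, root mu z & lam = z ^+ M.
Proof.
move=> nz_mu mu_gen root_lam; have [rs eqp_mu root_rs] := closed_field_roots nz_mu.
pose w : {poly C} := \prod_(z <- [seq z ^+ M | z <- rs]) ('X - z%:P).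
have w_pG : annihilates (w \Po 'X^M) pG.
  apply/mu_gen; rewrite (eqp_dvdl _ eqp_mu) /w big_map rmorph_prod.
  elim/big_ind2: _ => [|? ? ? ? /dvdp_mul|z _]; [exact: dvdpp|exact|].
  by rewrite /= dvdp_XsubCl comp_polyB comp_polyX comp_polyC rootE !hornerE subrr.
have nz_dil : gam *: affine_subst M%:R m%:R p != 0.
  rewrite scaler_eq0 negb_or nz_gam affine_subst_eq0 // pchar0_natr_eq0 //.
  by rewrite -lt0n ltnW.
have w_power := self_similar_power_annihilates w_pG.
have := annihilator_root pchar0 nz_dil nz_mu mu_gen w_power root_lam.
by rewrite root_prod_XsubC => /mapP[z z_rs ->]; exists z; rewrite ?root_rs.
Qed.

Lemma self_similar_quasi_polynomial w : w != 0 -> annihilates w pG ->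
  exists2 R, (0 < R)%N & forall b, exists q : {poly C},
    \forall a \near \oo, p.[(R * a + b)%:R] * G (R * a + b)%N = q.[a%:R].
Proof.
move=> nz_w w_pG; have [mu nz_mu mu_gen] := annihilator_generator nz_w w_pG.
have [rs eqp_mu root_rs] := closed_field_roots nz_mu.
have [|z|R R_gt0 unity] := roots_of_unity_of_pow_surj (rs := rs) M_gt1.
- by rewrite -root_rs; apply/negP => /(annihilator_root_neq0 nz_mu mu_gen)/eqP.
- rewrite -root_rs => /(self_similar_annihilator_pow_surj nz_mu mu_gen)[y].
  by rewrite root_rs; exists y.
exists R => // b; apply: (annihilates_unipotent pchar0 (e := size rs)).
have ann_pG : annihilates ((('X - 1) ^+ size rs) \Po 'X^R) pG.
  apply/mu_gen; rewrite (eqp_dvdl _ eqp_mu) rmorphXn /= -iter_mulr_1.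
  rewrite -(count_predT rs) -big_const_seq big_seq [X in _ %| X]big_seq.
  elim/big_ind2: _ => [|? ? ? ? /dvdp_mul|z z_rs]; [exact: dvdpp|exact|].
  by rewrite dvdp_XsubCl comp_polyB comp_polyX rmorph1 rootE !hornerE unity // subrr.
apply: filterS (near_affine b R_gt0 ann_pG) => n.
by rewrite (shift_op_comp_Xn R b _ pG).
Qed.

End QuasiPolynomial.

Section DilationEigenvectors.
Variables (F : fieldType) (mu : F).
Hypotheses (nz_mu : mu != 0) (mu_inf_order : injective (fun n => mu ^+ n)).
Implicit Types p q : {poly F}.

Local Notation dilate := (affine_subst mu 0).

Lemma coef_dilate p i : (dilate p)`_i = p`_i * mu ^+ i.
Proof.
rewrite /affine_subst addr0; elim/poly_ind: p i => [|p c IHp] i.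
  by rewrite comp_poly0 !coef0 mul0r.
rewrite comp_poly_MXaddC -scalerAr coefD coefZ coefMX coefC IHp coefD coefMX coefC.
by case: i => [|i] /=; rewrite ?mulr0 ?expr0 ?mulr1 // !addr0 mulrCA -exprS mulrC.
Qed.

Lemma dilate_eigen_monomial p : dilate p %= p -> exists c k, p = c *: 'X^k.
Proof.
move=> /eqpP[[a b] /= /andP[nz_a nz_b] eigen]; exists (lead_coef p), (size p).-1.
have [->|nz_p] := eqVneq p 0; first by rewrite lead_coef0 scale0r.
have eigen_coef i : p`_i != 0 -> a * mu ^+ i = b.
  move=> nz_pi; apply: (mulfI nz_pi); have := congr1 (fun q : {poly F} => q`_i) eigen.
  by rewrite !coefZ coef_dilate mulrCA => ->; rewrite mulrC.
apply/polyP => i; rewrite coefZ coefXn; have [->|ne_i] := eqVneq i (size p).-1.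
  by rewrite mulr1.
rewrite mulr0; apply/eqP; apply: contraNT ne_i => nz_pi.
rewrite -(inj_eq mu_inf_order); apply/eqP/(mulfI nz_a).
by rewrite (eigen_coef i) // eigen_coef // -lead_coefE lead_coef_eq0.
Qed.

Lemma dilate_eigen_coprime_monomial p q : coprimep p q ->
  dilate p * q %= p * dilate q -> exists c k, p = c *: 'X^k.
Proof.
move=> cop_pq eigen; apply: dilate_eigen_monomial.
have [p0|nz_p] := eqVneq p 0; first by rewrite p0 rmorph0 eqpxx.
have dvd_p : p %| dilate p.
  by rewrite -(Gauss_dvdpl _ cop_pq) (eqp_dvdr _ eigen) dvdp_mulr.
by rewrite eqp_sym -dvdp_size_eqp // size_affine_subst.
Qed.

Lemma dilate_eigen_ratio p q : p != 0 -> q != 0 -> dilate p * q %= p * dilate q ->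
  exists c a b, c != 0 /\ 'X^b * p = c *: ('X^a * q).
Proof.
move=> nz_p nz_q; pose g := gcdp p q; pose p1 := p %/ g; pose q1 := q %/ g.
have nz_g : g != 0 by rewrite gcdp_eq0 negb_and nz_p.
have cop : coprimep p1 q1 by rewrite coprimep_div_gcd ?nz_p.
have [def_p def_q] : p = p1 * g /\ q = q1 * g by rewrite !divpK ?dvdp_gcdl ?dvdp_gcdr.
have nz_dil_g : dilate g != 0 by rewrite affine_subst_eq0.
rewrite def_p def_q !rmorphM [_ * (q1 * g)]mulrACA [_ * (_ * dilate g)]mulrACA.
rewrite [g * dilate g]mulrC eqp_mul2r ?mulf_neq0 // => eigen.
have [c [a def_p1]] := dilate_eigen_coprime_monomial cop eigen.
have [e [b def_q1]] : exists e b, q1 = e *: 'X^b.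
  apply: (@dilate_eigen_coprime_monomial q1 p1); first by rewrite coprimep_sym.
  by rewrite mulrC eqp_sym [q1 * _]mulrC.
have nz_c : c != 0 by apply: contraNneq nz_p => c0; rewrite def_p def_p1 c0 scale0r mul0r.
have nz_e : e != 0 by apply: contraNneq nz_q => e0; rewrite def_q def_q1 e0 scale0r mul0r.
exists (c / e), a, b; split; first by rewrite mulf_neq0 ?invr_eq0.
rewrite def_p1 def_q1 -!scalerAl -!scalerAr scalerA divfK //.
by congr (_ *: _); rewrite mulrCA.
Qed.

End DilationEigenvectors.

(** * Multiplicative P-recursive sequences *)

Section UnitMultipliers.
Variables (C : fieldType) (f : nat -> C).

Definition unit_multiplier (a : nat) : Prop :=
  f a != 0 /\ forall n, (0 < n)%N -> f (a * n)%N = f a * f n.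

Lemma unit_multiplierM a b : (0 < b)%N ->
  unit_multiplier a -> unit_multiplier b -> unit_multiplier (a * b).
Proof.
move=> b_gt0 [nz_fa fa] [nz_fb fb]; split; first by rewrite fa // mulf_neq0.
by move=> n n_gt0; rewrite -mulnA !fa ?muln_gt0 ?b_gt0 // fb // mulrA.
Qed.

Hypothesis f_mul : multiplicative_fun f.

Lemma multiplicative_fun1 : ~ eventually_zero f -> f 1%N = 1.
Proof.
move=> f_nz; have f11 : f 1%N = f 1%N * f 1%N by rewrite -f_mul.
have [f10|nz_f1] := eqVneq (f 1%N) 0; last by apply: (mulfI nz_f1); rewrite mulr1 -f11.
case: f_nz; exists 1%N => n n_gt0; rewrite -[n]mul1n f_mul ?f10 ?mul0r //.
exact: coprime1n.
Qed.

Lemma multiplicative_fun0_exact_power l k n : prime l -> f (l ^ k)%N = 0 ->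
  n = l ^ k %[mod l ^ k.+1] -> f n = 0.
Proof.
move=> pr_l f_lk0 eq_n; have l_gt1 := prime_gt1 pr_l; have l_gt0 := prime_gt0 pr_l.
have -> : n = (l ^ k * (n %/ l ^ k.+1 * l + 1))%N.
  rewrite {1}(divn_eq n (l ^ k.+1)) eq_n modn_small ?ltn_exp2l //.
  by rewrite expnS mulnDr muln1 [(l * _)%N]mulnC mulnCA.
rewrite f_mul ?expn_gt0 ?l_gt0 ?addn1 // ?f_lk0 ?mul0r //.
by apply: coprimeXl; rewrite prime_coprime // -addn1 dvdn_addr ?dvdn_mull // dvdn1 gtn_eqF.
Qed.

Lemma multiplicative_zero_windows :
  (forall B, exists l k, [/\ prime l, (B < l)%N & f (l ^ k)%N = 0]) ->
  forall s, exists Q a, (0 < Q)%N /\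
    forall n, n = a %[mod Q] -> forall i, (i < s)%N -> f (n + i)%N = 0.
Proof.
move=> zeros; elim=> [|s [Q [a [Q_gt0 zero_a]]]]; first by exists 1%N, 0%N.
have [l [k [pr_l lt_Ql f_lk0]]] := zeros Q; pose L := (l ^ k.+1)%N.
have L_gt0 : (0 < L)%N by rewrite expn_gt0 prime_gt0.
have cop : coprime Q L by rewrite coprimeXr // coprime_sym prime_coprime // gtnNdvd.
pose b := (l ^ k + s * (L - 1))%N.
exists (Q * L)%N, (chinese Q L a b); rewrite muln_gt0 Q_gt0 L_gt0; split=> // n eq_n i.
rewrite ltnS leq_eqVlt => /orP[/eqP->|]; last first.
  apply: zero_a; rewrite -(chinese_modl cop a b).
  by have := congr1 (modn^~ Q) eq_n; rewrite !modn_dvdm ?dvdn_mulr.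
have eq_nb : n = b %[mod L].
  rewrite -(chinese_modr cop a b).
  by have := congr1 (modn^~ L) eq_n; rewrite !modn_dvdm ?dvdn_mull.
apply: (multiplicative_fun0_exact_power pr_l f_lk0); rewrite -/L -modnDml eq_nb modnDml /b.
rewrite -addnA (_ : s * (L - 1) + s = s * L)%N; last by rewrite -{2}(muln1 s) -mulnDr subnK.
by rewrite addnC modnMDl.
Qed.

Variable r : nat.
Hypotheses (pchar0 : has_pchar0 C) (f_rec : precursive r f) (f_nz : ~ eventually_zero f).

Lemma multiplicative_prime_powers_neq0 :
  exists B, forall l k, prime l -> (B < l)%N -> f (l ^ k)%N != 0.
Proof.
apply: contrapT => no_B; apply: f_nz.
have zeros B : exists l k, [/\ prime l, (B < l)%N & f (l ^ k)%N = 0].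
  apply: contrapT => no_l; apply: no_B; exists B => l k pr_l lt_Bl; apply/eqP => f_lk0.
  by apply: no_l; exists l, k.
have [Q [a [Q_gt0 zero_a]]] := multiplicative_zero_windows zeros r.
have [N _ f0] : \forall n \near \oo, f n = 0.
  apply: (precursive_zero_windows pchar0 f_rec) => N; exists (a + N * Q)%N; first by nia.
  by apply: zero_a; rewrite addnC modnMDl.
by exists N.
Qed.

Lemma precursive_sparse s l (h : nat -> C) : precursive s h -> (s < l)%N ->
  (forall n, (0 < n)%N -> ~~ (l %| n)%N -> h n = 0) -> \forall n \near \oo, h n = 0.
Proof.
move=> h_rec lt_sl h0; apply: (precursive_zero_windows pchar0 h_rec) => N.
exists (N * l + 1)%N => [|i lt_is]; first by nia.
apply: h0; first by rewrite addn1.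
rewrite -addnA dvdn_addr ?dvdn_mull // gtnNdvd //.
by rewrite add1n (leq_ltn_trans lt_is).
Qed.

Lemma prime_unit_multiplier B l :
  (forall l k, prime l -> (B < l)%N -> f (l ^ k)%N != 0) ->
  prime l -> (r + r < l)%N -> (B < l)%N -> unit_multiplier l.
Proof.
move=> nz_f pr_l lt_rl lt_Bl; have l_gt0 := prime_gt0 pr_l.
split=> [|n n_gt0]; first by have := nz_f l 1%N pr_l lt_Bl; rewrite expn1.
pose h n := f (l * n + 0)%N + - f l * f n.
have h_rec : precursive (r + r) h.
  by apply: precursiveD; [apply: precursive_section|apply: precursiveZ].
have [N _ h0] : \forall n \near \oo, h n = 0.
  apply: precursive_sparse h_rec lt_rl _ => k k_gt0 l_ndvd_k.
  by rewrite /h addn0 f_mul ?prime_coprime // mulNr subrr.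
have [u lt_u pr_u] := prime_above (maxn (maxn B N) (l * n)).
rewrite !gtn_max in lt_u; case/andP: lt_u => /andP[lt_Bu lt_Nu] lt_lnu.
have nz_fu : f u != 0 by have := nz_f u 1%N pr_u lt_Bu; rewrite expn1.
have f_u k : (0 < k)%N -> (k <= l * n)%N -> f (k * u)%N = f k * f u.
  move=> k_gt0 le_k; apply: f_mul (prime_gt0 pr_u) _ => //; rewrite coprime_sym prime_coprime //.
  by rewrite gtnNdvd // (leq_ltn_trans le_k).
have /eqP := h0 (n * u)%N (leq_trans (ltnW lt_Nu) (leq_pmull _ n_gt0)).
rewrite /h addn0 mulnA !f_u ?muln_gt0 ?l_gt0 ?leq_pmull // mulrA -mulrDl.
by rewrite mulf_eq0 (negPf nz_fu) orbF mulNr subr_eq0 => /eqP.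
Qed.

Lemma coprime_unit_multiplier : exists2 Q, (0 < Q)%N &
  forall a, (0 < a)%N -> coprime a Q -> unit_multiplier a.
Proof.
have [B nz_f] := multiplicative_prime_powers_neq0.
pose B' := maxn B (r + r); exists B'`!%N => [|a]; first exact: fact_gt0.
elim/ltn_ind: a => a IHa a_gt0 cop_a; have [a_gt1|le_a1] := ltnP 1 a; last first.
  have -> : a = 1%N by lia.
  by rewrite /unit_multiplier multiplicative_fun1 // oner_eq0; split=> // n _; rewrite mul1n mul1r.
pose l := pdiv a; have pr_l : prime l := pdiv_prime a_gt1.
have def_a : a = (l * (a %/ l))%N by rewrite mulnC divnK // pdiv_dvd.
have al_gt0 : (0 < a %/ l)%N by rewrite divn_gt0 ?prime_gt0 // pdiv_leq.
move: cop_a; rewrite {1}def_a coprimeMl prime_coprime // => /andP[l_ndvd cop_al].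
have lt_B'l : (B' < l)%N.
  by rewrite ltnNge; apply: contra l_ndvd => le_l; apply: dvdn_fact; rewrite prime_gt0.
rewrite gtn_max in lt_B'l; case/andP: lt_B'l => lt_Bl lt_rl; rewrite def_a.
apply: unit_multiplierM => //; first exact: prime_unit_multiplier nz_f pr_l lt_rl lt_Bl.
by apply: IHa => //; rewrite ltn_Pdiv // prime_gt1.
Qed.

End UnitMultipliers.

Lemma coprime_mulnD1 (Q R t : nat) : (Q %| R)%N -> coprime (R * t + 1) Q.
Proof.
move=> Q_dvd_R; apply: coprime_dvdr Q_dvd_R _.
by rewrite coprime_sym /coprime mulnC gcdnMDl gcdn1.
Qed.

Section PowerLaw.
Variables (C : closedFieldType) (f : nat -> C) (r Q : nat).
Hypotheses (pchar0 : has_pchar0 C) (f_rec : precursive r f) (Q_gt0 : (0 < Q)%N).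
Hypothesis f_unit : forall a, (0 < a)%N -> coprime a Q -> unit_multiplier f a.

Lemma mulnD1_unit_multiplier R t : (Q %| R)%N -> unit_multiplier f (R * t + 1).
Proof. by move=> Q_dvd_R; apply: f_unit; rewrite ?addn1 // -addn1 coprime_mulnD1. Qed.

Lemma rational_on_progression : exists R (p q : {poly C}),
  [/\ (0 < R)%N, (Q %| R)%N, p != 0, q != 0 &
    \forall t \near \oo, q.[(R * t + 1)%:R] * f (R * t + 1)%N = p.[(R * t + 1)%:R]].
Proof.
pose G t := f (Q * t + 1)%N.
have nz_G t : G t != 0 := (mulnD1_unit_multiplier t (dvdnn Q)).1.
have self_similar a : G (Q.+1 * a + 1)%N = G 1%N * G a.
  rewrite /G -(mulnD1_unit_multiplier 1 (dvdnn Q)).2 ?addn1 //.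
  by congr f; lia.
have G_nz : ~ (\forall n \near \oo, G n = 0) by move/filter_ex => [n /eqP]; apply/negP.
have Q1_gt1 : (1 < Q.+1)%N by [].
have [q nz_q [w nz_w w_qG]] := self_similar_recurrence pchar0
  (precursive_section pchar0 1 Q_gt0 f_rec) G_nz Q1_gt1 (nz_G 1%N) self_similar.
have [S S_gt0 quasi_poly] :=
  self_similar_quasi_polynomial pchar0 Q1_gt1 (nz_G 1%N) nz_q self_similar nz_w w_qG.
have [p qGp] := quasi_poly 0%N; pose R := (Q * S)%N.
have R_gt0 : (0 < R)%N by rewrite muln_gt0 Q_gt0.
have nz_R : R%:R != 0 :> C by rewrite pchar0_natr_eq0 // -lt0n.
have nz_S : S%:R != 0 :> C by rewrite pchar0_natr_eq0 // -lt0n.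
pose undilate : {poly C} -> {poly C} := affine_subst R%:R^-1 (- (1%:R / R%:R)).
have undilateE u t : (undilate u).[(R * t + 1)%:R] = u.[t%:R].
  by rewrite -horner_affine_subst_natr affine_substVK.
have eq_f : \forall t \near \oo, (affine_subst S%:R 0%:R q).[t%:R] * f (R * t + 1)%N = p.[t%:R].
  apply: filterS qGp => t <-; rewrite horner_affine_subst_natr; congr (_ * f _).
  by rewrite /R; lia.
exists R, (undilate p), (undilate (affine_subst S%:R 0%:R q)); split=> //.
- exact: dvdn_mulr.
- rewrite affine_subst_eq0 ?invr_eq0 //; apply: contraNneq nz_q => p0.
  rewrite -(affine_subst_eq0 0%:R q nz_S); apply/eqP.
  apply: (poly_eq0_progression pchar0 (b := 0) (ltn0Sn 0)).
  apply: filterS eq_f => t; rewrite p0 horner0 mul1n addn0 => /eqP.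
  rewrite mulf_eq0 (negPf (mulnD1_unit_multiplier t _).1) ?orbF => [/eqP//|].
  exact: dvdn_mulr.
- by rewrite !affine_subst_eq0 ?invr_eq0.
- by apply: filterS eq_f => t; rewrite !undilateE.
Qed.

Lemma dilate_eigen_of_progression R (p q : {poly C}) : (0 < R)%N -> (Q %| R)%N ->
  (\forall t \near \oo, q.[(R * t + 1)%:R] * f (R * t + 1)%N = p.[(R * t + 1)%:R]) ->
  affine_subst (R + 1)%:R 0 p * q = f (R + 1)%N *: (p * affine_subst (R + 1)%:R 0 q).
Proof.
move=> R_gt0 Q_dvd_R eq_f; apply/eqP; rewrite -subr_eq0; apply/eqP.
apply: (poly_eq0_progression pchar0 (b := 1) R_gt0).
apply: filterS2 eq_f (near_affine 1 (ltn0Sn R) eq_f) => t.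
have -> : (R * (R.+1 * t + 1) + 1 = (R + 1) * (R * t + 1))%N by lia.
have [_ fM] := mulnD1_unit_multiplier 1 Q_dvd_R; rewrite muln1 in fM.
rewrite fM ?addn1 // hornerD hornerN hornerZ !hornerM !horner_affine_subst !addr0 -natrM.
by move=> <- <-; ring.
Qed.

Lemma near_power_law : exists R (c : C) (k : int), [/\ (0 < R)%N, (Q %| R)%N, c != 0 &
  \forall t \near \oo, f (R * t + 1)%N = c * (R * t + 1)%:R ^ k].
Proof.
have [R [p [q [R_gt0 Q_dvd_R nz_p nz_q eq_f]]]] := rational_on_progression.
have nz_M : (R + 1)%:R != 0 :> C by rewrite pchar0_natr_eq0 // addn1.
have M_inf_order : injective (fun n => (R + 1)%:R ^+ n : C).
  move=> i j; rewrite /= -!natrX => /(pchar0_natr_inj pchar0)/eqP.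
  by rewrite eqn_exp2l ?addn1 // => /eqP.
have eigen : affine_subst (R + 1)%:R 0 p * q %= p * affine_subst (R + 1)%:R 0 q.
  rewrite (dilate_eigen_of_progression R_gt0 Q_dvd_R eq_f) eqp_scale //.
  by have := (mulnD1_unit_multiplier 1 Q_dvd_R).1; rewrite muln1.
have [c [a [b [nz_c ratio]]]] := dilate_eigen_ratio nz_M M_inf_order nz_p nz_q eigen.
exists R, c, (a%:Z - b%:Z); split=> //.
apply: filterS2 eq_f (near_affine 1 R_gt0 (near_horner_neq0 pchar0 nz_q)) => t.
have : ((R * t + 1)%:R : C) != 0 by rewrite pchar0_natr_eq0 // addn1.
move: (f _) (_%:R) => fN N nz_N eq_fN nz_qN; rewrite expfzDr // -exprnN -exprnP.
have nz_Nb := expf_neq0 b nz_N; apply: (mulfI nz_Nb); apply: (mulfI nz_qN).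
have /(congr1 (horner^~ N)) := ratio; rewrite /= hornerZ !hornerM !hornerXn -eq_fN => eq_N.
by rewrite mulrCA eq_N; move: (N ^+ a) (N ^+ b) nz_Nb => x y nz_y; field.
Qed.

Lemma power_law : exists R (k : int), [/\ (0 < R)%N, (Q %| R)%N &
  forall t, f (R * t + 1)%N = (R * t + 1)%:R ^ k].
Proof.
have [R [c [k [R_gt0 Q_dvd_R nz_c [s _ law]]]]] := near_power_law; exists R, k; split=> // t.
pose K := (R * s + 1)%N; pose N := (R * t + 1)%N; rewrite -/N.
have fK : f K = c * K%:R ^ k := law s (leqnn s).
have fKN : f (K * N)%N = c * (K * N)%:R ^ k.
  have -> : (K * N = R * (s + t * K) + 1)%N by rewrite /N mulnDr muln1 /K; ring.
  by apply: law; exact: leq_addr.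
have [nz_fK f_mulK] := mulnD1_unit_multiplier s Q_dvd_R.
have N_gt0 : (0 < N)%N by rewrite /N addn1.
by apply: (mulfI nz_fK); rewrite -f_mulK // -/K fKN fK natrM expfzMl mulrA.
Qed.

End PowerLaw.

Lemma partn_dvd_exp (n R c : nat) : (0 < n)%N ->
  (forall q, prime q -> (q %| R)%N -> ~~ (q ^ c.+1 %| n)%N) -> (n`_\pi(R) %| R ^ c)%N.
Proof.
move=> n_gt0 free; apply/dvdn_partP => [|q]; first exact: part_gt0.
rewrite pi_of_part // inE /= => /andP[_ q_R].
have /and3P[pr_q _ q_dvd_R] : [&& prime q, (0 < R)%N & (q %| R)%N] by rewrite -mem_primes.
rewrite partn_part; last by move=> _ /eqP->.
rewrite p_part (dvdn_trans _ (dvdn_exp2r c q_dvd_R)) // dvdn_exp2l //.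
by have := free q pr_q q_dvd_R; rewrite pfactor_dvdn // -leqNgt.
Qed.

Section Periodicity.
Variables (C : fieldType) (g : nat -> C) (r R : nat).
Hypotheses (pchar0 : has_pchar0 C) (g_rec : precursive r g) (R_gt0 : (0 < R)%N).
Hypothesis g_unit : forall a, (0 < a)%N -> coprime a R -> unit_multiplier g a.
Hypothesis g_mod1 : forall t, g (R * t + 1)%N = 1.

Lemma unit_multiplier_eq_mod u v : (0 < u)%N -> (0 < v)%N -> coprime u R ->
  u = v %[mod R] -> g u = g v.
Proof.
move=> u_gt0 v_gt0 cop_u eq_uv; pose w := (u ^ (totient R).-1)%N.
have w_gt0 : (0 < w)%N by rewrite expn_gt0 u_gt0.
have wu1 : (w * u = 1 %[mod R])%N.
  by rewrite /w -expnSr prednK ?totient_gt0 // Euler_exp_totient.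
have [nz_gw gw] := g_unit w_gt0 (coprimeXl _ cop_u).
have gw1 x : (0 < x)%N -> x = u %[mod R] -> g w * g x = 1.
  move=> x_gt0 eq_xu; have wx_gt0 : (0 < w * x)%N by rewrite muln_gt0 w_gt0.
  have /eqP : (w * x = 1 %[mod R])%N by rewrite -modnMmr eq_xu modnMmr.
  rewrite eqn_mod_dvd // => /dvdnP[t def_wx].
  by rewrite -gw // -(subnK wx_gt0) def_wx mulnC.
by apply: (mulfI nz_gw); rewrite !gw1.
Qed.

Lemma unit_multiplier_shift_exp c n : (0 < n)%N ->
  (forall q, prime q -> (q %| R)%N -> ~~ (q ^ c.+1 %| n)%N) -> g (n + R ^ c.+1)%N = g n.
Proof.
move=> n_gt0 free; pose m := (n`_\pi(R))%N; pose v := (n`_(\pi(R)^'))%N.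
have def_n : n = (v * m)%N by rewrite mulnC partnC.
have cop_v : coprime v R by rewrite coprime_sym coprime_pi' ?part_gt0 // part_pnat.
have [k def_Rc] := dvdnP (partn_dvd_exp n_gt0 free).
have def_nR : (n + R ^ c.+1 = (v + R * k) * m)%N by rewrite mulnDl -def_n expnS def_Rc mulnA.
have cop_vR : coprime (v + R * k) R.
  by rewrite coprime_sym /coprime addnC mulnC gcdnMDl -/(coprime R v) coprime_sym.
have [v_gt0 m_gt0] : (0 < v)%N /\ (0 < m)%N by rewrite !part_gt0.
have vR_gt0 : (0 < v + R * k)%N by rewrite addn_gt0 v_gt0.
rewrite def_nR {1}def_n (g_unit vR_gt0 cop_vR).2 // (g_unit v_gt0 cop_v).2 //.
by congr (_ * _); symmetry; apply: unit_multiplier_eq_mod => //; rewrite addnC mulnC modnMDl.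
Qed.

Lemma unit_multiplier_periodic : periodic_fun g.
Proof.
pose c := (r + r)%N; pose P := (R ^ c.+1)%N; have P_gt0 : (0 < P)%N by rewrite expn_gt0 R_gt0.
have [N _ g_shift] : \forall n \near \oo, g (1 * n + P)%N + -1 * g n = 0.
  have h_rec : precursive c (fun n => g (1 * n + P)%N + -1 * g n).
    by apply: precursiveD; [apply: precursive_section|apply: precursiveZ].
  apply: (precursive_zero_windows pchar0 h_rec) => N.
  exists (P * N + 1)%N => [|i lt_ic]; first by nia.
  rewrite mul1n unit_multiplier_shift_exp ?mulN1r ?subrr ?addn1 // => q pr_q q_dvd_R.
  rewrite addSnnS dvdn_addr; last by rewrite dvdn_mulr // dvdn_exp2r.
  rewrite gtnNdvd // (leq_ltn_trans lt_ic) // (leq_trans (ltn_expl c (prime_gt1 pr_q))) //.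
  by rewrite leq_exp2l ?prime_gt1.
have near_per k n : (N <= n)%N -> g (n + k * P)%N = g n.
  move=> le_Nn; elim: k => [|k IHk]; first by rewrite addn0.
  have /eqP := g_shift (n + k * P)%N (leq_trans le_Nn (leq_addr _ _)).
  by rewrite mul1n mulN1r subr_eq0 IHk -addnA -mulSnr => /eqP.
pose u := (R * N + 1)%N; have u_gt0 : (0 < u)%N by rewrite /u addn1.
have g_u n : (0 < n)%N -> g (u * n)%N = g n.
  move=> n_gt0; have [_ ->] := g_unit u_gt0 (coprime_mulnD1 N (dvdnn R)); last by [].
  by rewrite g_mod1 mul1r.
exists P => // n n_gt0; rewrite -g_u ?addn_gt0 ?n_gt0 // mulnDr near_per ?g_u //.
by rewrite /u; nia.
Qed.

End Periodicity.

(** * Algebraic power series *)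

Section PowerSeries.
Variable K : fieldType.
Implicit Types (F a b : fps K) (P : {poly {poly K}}) (c : {poly K}).

Local Notation phi := (@fps_of_poly K).

Lemma fcoef_sum (I : Type) (r : seq I) (a : I -> fps K) n :
  fcoef (\sum_(i <- r) a i) n = \sum_(i <- r) fcoef (a i) n.
Proof. by elim: r => [|i r IHr]; rewrite ?big_nil // !big_cons /= IHr. Qed.

Lemma fps_of_poly_eq0 c : (phi c == 0) = (c == 0).
Proof. by rewrite -(inj_eq (@fps_of_poly_inj K)) rmorph0. Qed.

Lemma fcoef_polyM d c a n : (size c <= d.+1)%N ->
  fcoef (phi c * a) (n + d) = \sum_(i < d.+1) c`_(d - i) * fcoef a (n + i).
Proof.
move=> le_c; rewrite [RHS](reindex_inj rev_ord_inj) /= [RHS](big_ord_widen (n + d).+1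
  (fun i => c`_(d - (d.+1 - i.+1)) * fcoef a (n + (d.+1 - i.+1)))) ?ltnS ?leq_addl //.
rewrite [RHS]big_mkcond; apply: eq_bigr => i _; rewrite ltnS subSS.
case: leqP => [le_id|lt_di]; last by rewrite nth_default ?mul0r // (leq_trans le_c).
by rewrite subKn // addnBA.
Qed.

(* The derivation [z d/dz]. *)
Definition theta a : fps K := Fps (fun n => n%:R * fcoef a n).

Fact theta_is_zmod_morphism : zmod_morphism theta.
Proof. by move=> a b; apply: fpsP => n /=; rewrite mulrBr. Qed.
HB.instance Definition _ :=
  GRing.isZmodMorphism.Build (fps K) (fps K) theta theta_is_zmod_morphism.

Lemma thetaM a b : theta (a * b) = theta a * b + a * theta b.
Proof.
apply: fpsP => n /=; rewrite mulr_sumr -big_split /=; apply: eq_bigr => j _.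
have -> : n%:R = j%:R + (n - j)%:R :> K by rewrite -natrD subnKC // -ltnS.
by ring.
Qed.

Lemma theta1 : theta 1 = 0.
Proof. by apply: fpsP => -[|n] /=; rewrite ?mul0r ?mulr0. Qed.

Lemma theta_exp a k : theta (a ^+ k) * a = k%:R * (a ^+ k * theta a).
Proof.
elim: k => [|k IHk]; first by rewrite theta1 !mul0r.
by rewrite exprS thetaM mulrDl -[a * theta _ * a]mulrA IHk -natr1; ring.
Qed.

Lemma fcoef_iter_theta k a n : fcoef (iter k theta a) n = n%:R ^+ k * fcoef a n.
Proof. by elim: k => [|k IHk] /=; rewrite ?mul1r // IHk exprS mulrA. Qed.

Definition theta_poly c : {poly K} := 'X * c^`().

Fact theta_poly_is_zmod_morphism : zmod_morphism theta_poly.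
Proof. by move=> c d; rewrite /theta_poly derivB mulrBr. Qed.
HB.instance Definition _ :=
  GRing.isZmodMorphism.Build {poly K} {poly K} theta_poly theta_poly_is_zmod_morphism.

Lemma theta_fps_of_poly c : theta (phi c) = phi (theta_poly c).
Proof.
apply: fpsP => -[|n]; rewrite /= coefXM /= ?mul0r //.
by rewrite coef_deriv -[in RHS]mulr_natl.
Qed.

Definition eval_series F P : fps K := (map_poly phi P).[F].

Fact eval_series_is_zmod_morphism F : zmod_morphism (eval_series F).
Proof. by move=> P Q; rewrite /eval_series rmorphB hornerD hornerN. Qed.
HB.instance Definition _ F := GRing.isZmodMorphism.Build {poly {poly K}} (fps K)
  (eval_series F) (eval_series_is_zmod_morphism F).

Fact eval_series_is_monoid_morphism F : monoid_morphism (eval_series F).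
Proof.
by split=> [|P Q]; rewrite /eval_series ?rmorph1 ?hornerC // rmorphM hornerM.
Qed.
HB.instance Definition _ F := GRing.isMonoidMorphism.Build {poly {poly K}} (fps K)
  (eval_series F) (eval_series_is_monoid_morphism F).

Lemma eval_seriesC F c : eval_series F c%:P = phi c.
Proof. by rewrite /eval_series map_polyC hornerC. Qed.

Lemma eval_seriesX F : eval_series F 'X = F.
Proof. by rewrite /eval_series map_polyX hornerX. Qed.

Lemma eval_seriesZ F c P : eval_series F (c *: P) = phi c * eval_series F P.
Proof. by rewrite -mul_polyC rmorphM /= eval_seriesC. Qed.

Lemma theta_eval_series F P :
  theta (eval_series F P) = eval_series F (map_poly theta_poly P) + eval_series F P^`() * theta F.
Proof.
elim/poly_ind: P => [|P c IHP]; first by rewrite map_poly0 deriv0 !rmorph0 mul0r addr0 raddf0.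
have -> : map_poly theta_poly (P * 'X + c%:P) = map_poly theta_poly P * 'X + (theta_poly c)%:P.
  apply/polyP => i; rewrite coef_map coefD coefMX coefC coefD coefMX coefC coef_map.
  by case: i => [|i] /=; rewrite ?add0r ?addr0.
rewrite derivMXaddC !rmorphD !(rmorphM (eval_series F)) /= !eval_seriesX !eval_seriesC.
by rewrite raddfD /= thetaM IHP theta_fps_of_poly; ring.
Qed.

End PowerSeries.

Lemma common_denominator (K : fieldType) (p : {poly ratfun K}) :
  exists2 d : {poly K}, d != 0 & exists P, map_poly (@tofrac _) P = tofrac d *: p.
Proof.
elim/poly_ind: p => [|p u [d nz_d [P eqP]]].
  by exists 1; rewrite ?oner_eq0 //; exists 0; rewrite rmorph0 scaler0.
have nz_u : \d_(repr u) != 0 := denom_ratioP _.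
exists (d * \d_(repr u)); first by rewrite mulf_neq0.
exists (\d_(repr u) *: P * 'X + (d * \n_(repr u))%:P).
rewrite rmorphD rmorphM /= map_polyZ map_polyX map_polyC /= eqP scalerDr tofracM; congr (_ + _).
  by rewrite tofracM scalerA scalerAl [tofrac d * _]mulrC.
rewrite -mul_polyC -polyCM tofracM -mulrA; congr ((_ * _)%:P).
by rewrite {3}(ratfunE u) mulrC divfK // tofrac_eq0.
Qed.

Section AlgebraicSeries.
Variable K : fieldType.
Implicit Types (F a b y : fps K) (P Q : {poly {poly K}}) (c : {poly K}).

Local Notation phi := (@fps_of_poly K).

Lemma fps_algebraic_equation F : fps_algebraic F -> exists2 P, P != 0 & eval_series F P = 0.
Proof.
move=> [p nz_p /eqP root_p]; have [d nz_d [P map_P]] := common_denominator p; exists P.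
  apply: contraNneq nz_p => P0; move/eqP: map_P; rewrite P0 rmorph0 eq_sym scaler_eq0.
  by rewrite tofrac_eq0 (negPf nz_d).
apply/eqP; rewrite -tofrac_eq0; apply/eqP.
transitivity ((map_poly (@laurent_of_ratfun K) (map_poly (@tofrac _) P)).[tofrac F]).
  rewrite /eval_series -horner_map -!map_poly_comp; congr (_.[_]).
  by apply: eq_map_poly => c /=; rewrite laurent_of_ratfun_tofrac.
by rewrite map_P map_polyZ hornerZ root_p mulr0.
Qed.

Definition minimal_equation F P :=
  [/\ P != 0, eval_series F P = 0 & forall Q, (size Q < size P)%N -> eval_series F Q = 0 -> Q = 0].

Lemma fps_algebraic_minimal_equation F : fps_algebraic F -> exists P, minimal_equation F P.
Proof.
move=> /fps_algebraic_equation[P nz_P PF].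
exact: (exists_min_size_poly (P := fun P => eval_series F P = 0) nz_P PF).
Qed.

Lemma size_minimal_equation F P : minimal_equation F P -> exists m, size P = m.+2.
Proof.
move=> [nz_P PF _]; exists (size P).-2; suff : (1 < size P)%N by lia.
rewrite ltnNge; apply: contra nz_P => /size1_polyC def_P.
by move/eqP: PF; rewrite def_P eval_seriesC fps_of_poly_eq0 polyC_eq0.
Qed.

Definition fps_adjoin F : {pred fps K} := fun y => `[< exists P, y = eval_series F P >].

Fact fps_adjoin_zmod_closed F : zmod_closed (fps_adjoin F).
Proof.
split=> [|_ _ /asboolP[P ->] /asboolP[Q ->]]; apply/asboolP; first by exists 0; rewrite raddf0.
by exists (P - Q); apply: esym; apply: eval_series_is_zmod_morphism.
Qed.
HB.instance Definition _ F :=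
  GRing.isZmodClosed.Build (fps K) (fps_adjoin F) (fps_adjoin_zmod_closed F).

Fact fps_adjoin_mulr_closed F : mulr_closed (fps_adjoin F).
Proof.
split=> [|_ _ /asboolP[P ->] /asboolP[Q ->]]; apply/asboolP; first by exists 1; rewrite rmorph1.
by exists (P * Q); rewrite rmorphM.
Qed.
HB.instance Definition _ F :=
  GRing.isMulClosed.Build (fps K) (fps_adjoin F) (fps_adjoin_mulr_closed F).

Lemma eval_series_adjoin F P : eval_series F P \in fps_adjoin F.
Proof. by apply/asboolP; exists P. Qed.

Lemma fps_adjoin_dependence F P n (y : nat -> fps K) : P != 0 -> eval_series F P = 0 ->
  (size P <= n)%N -> (forall k, (k < n)%N -> y k \in fps_adjoin F) ->
  exists Q, [/\ Q != 0, (size Q <= n)%N & \sum_(k < n) phi Q`_k * y k = 0].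
Proof.
move=> nz_P PF le_Pn adj_y.
have /choice[g gE] (k : 'I_n) : exists g, y k = eval_series F g.
  by apply/asboolP/adj_y.
pose rem k := Pdiv.Ring.rmodp (g k) P.
pose scal k := lead_coef P ^+ Pdiv.Ring.rscalp (g k) P.
have nz_scal k : scal k != 0 by rewrite expf_neq0 ?lead_coef_eq0.
have remE k : phi (scal k) * y k = eval_series F (rem k).
  by rewrite gE -eval_seriesZ Pdiv.ComRing.rdivp_eq rmorphD rmorphM /= PF mulr0 add0r.
have size_rem k : (size (rem k) <= (size P).-1)%N.
  by rewrite -ltnS -polySpred // Pdiv.Ring.ltn_rmodp.
have lt_Pn : ((size P).-1 < n)%N by rewrite -polySpred.
have [v nz_v v_rem] := exists_left_kernel (\matrix_(k < n, i < (size P).-1) (rem k)`_i) lt_Pn.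
have v_rem0 : \sum_k v 0 k *: rem k = 0.
  apply/polyP => i; rewrite coef_sum coef0; have [lt_i|le_i] := ltnP i (size P).-1; last first.
    by rewrite big1 // => k _; rewrite coefZ nth_default ?mulr0 // (leq_trans (size_rem k)).
  have /rowP/(_ (Ordinal lt_i)) := v_rem; rewrite !mxE => v_i.
  by rewrite -[RHS]v_i; apply: eq_bigr => k _; rewrite coefZ mxE.
exists (rVpoly (\row_k (v 0 k * scal k))); split; last 1 first.
- rewrite -[RHS](rmorph0 (eval_series F)) -v_rem0 rmorph_sum; apply: eq_bigr => k _.
  by rewrite coef_rVpoly_ord mxE rmorphM -mulrA remE /= eval_seriesZ.
- have /rV0Pn[k nz_vk] := nz_v; apply: contraNneq nz_vk => /(congr1 (fun Q => Q`_k)) /eqP.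
  by rewrite coef_rVpoly_ord mxE coef0 mulf_eq0 (negPf (nz_scal k)) orbF.
- exact: size_poly.
Qed.

Hypothesis pchar0 : has_pchar0 K.

Section MinimalEquation.
Variables (F : fps K) (P : {poly {poly K}}).
Hypothesis min_P : minimal_equation F P.

Local Notation w := (eval_series F P^`()).

Lemma eval_series_deriv_neq0 : w != 0.
Proof.
have [nz_P _ min] := min_P; have [m sizeP] := size_minimal_equation min_P.
apply/eqP => /(min _ (lt_size_deriv nz_P))/(congr1 (fun Q : {poly {poly K}} => Q`_m))/eqP.
rewrite coef_deriv coef0 -mulr_natr mulf_eq0 -polyC_natr polyC_eq0 pchar0_natr_eq0 // orbF.
by rewrite -[m.+1]/(m.+2.-1) -sizeP -lead_coefE lead_coef_eq0 (negPf nz_P).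
Qed.

Lemma deriv_mul_theta : w * theta F = - eval_series F (map_poly (@theta_poly K) P).
Proof.
have [_ PF _] := min_P; apply/eqP; rewrite -addr_eq0 addrC.
by rewrite -theta_eval_series PF raddf0.
Qed.

Lemma fps_adjoin_theta y : y \in fps_adjoin F -> w * theta y \in fps_adjoin F.
Proof.
move=> /asboolP[g ->]; rewrite theta_eval_series mulrDr mulrCA deriv_mul_theta.
by rewrite rpredD ?rpredM ?rpredN ?eval_series_adjoin.
Qed.

Lemma fps_adjoin_iter_theta k : w ^+ (2 * k) * iter k (@theta K) F \in fps_adjoin F.
Proof.
elim: k => [|k IHk]; first by rewrite mul1r -[F in X in X \in _]eval_seriesX eval_series_adjoin.
have w_adj : w \in fps_adjoin F := eval_series_adjoin F _.
have -> : w ^+ (2 * k.+1) * iter k.+1 (@theta K) F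
    = w * (w * theta (w ^+ (2 * k) * iter k (@theta K) F))
      - (2 * k)%:R * (w * theta w) * (w ^+ (2 * k) * iter k (@theta K) F).
  rewrite /= thetaM mulrDr [w * (theta _ * _)]mulrA [w * theta _]mulrC theta_exp mulnS exprD expr2.
  by move: (2 * k)%:R (w ^+ (2 * k)) => x v; ring.
exact: rpredB (rpredM w_adj (fps_adjoin_theta IHk))
  (rpredM (rpredM (rpred_nat _ _) (fps_adjoin_theta w_adj)) IHk).
Qed.

End MinimalEquation.

Lemma fps_algebraic_theta F : fps_algebraic F -> fps_algebraic (theta F).
Proof.
move=> F_alg; have [P min_P] := fps_algebraic_minimal_equation F_alg.
have alg_eval Q : fps_algebraic (eval_series F Q).
  elim/poly_ind: Q => [|Q c IHQ].
    by rewrite rmorph0 /fps_algebraic tofrac0; exact: algebraic0.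
  rewrite rmorphD rmorphM /= eval_seriesX eval_seriesC /fps_algebraic tofracD tofracM.
  rewrite -laurent_of_ratfun_tofrac.
  apply: algebraic_add; last exact: algebraic_id.
  exact: algebraic_mul IHQ F_alg.
have nz_w := eval_series_deriv_neq0 min_P; rewrite -tofrac_eq0 in nz_w.
have def_theta : tofrac (theta F) = tofrac (eval_series F
    (- map_poly (@theta_poly K) P)) / tofrac (eval_series F P^`()).
  apply: (mulIf nz_w); rewrite divfK // -tofracM mulrC (deriv_mul_theta min_P).
  by rewrite [eval_series F (- _)]raddfN.
by rewrite /fps_algebraic def_theta; apply: algebraic_div; apply: alg_eval.
Qed.

Lemma fps_algebraic_iter_theta k F : fps_algebraic F -> fps_algebraic (iter k (@theta K) F).
Proof.
move=> F_alg; elim: k => [|k IHk]; first exact: F_alg.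
by rewrite iterS; apply: fps_algebraic_theta.
Qed.

Lemma fps_algebraic_differential_equation F : fps_algebraic F -> exists Q n,
  [/\ Q != 0, (size Q <= n)%N & \sum_(k < n) phi Q`_k * iter k (@theta K) F = 0].
Proof.
move=> /fps_algebraic_minimal_equation[P min_P]; have [nz_P PF _] := min_P.
set w := eval_series F P^`(); pose n := size P.
have [k lt_kn|Q [nz_Q le_Qn rel]] := fps_adjoin_dependence nz_P PF (leqnn n)
    (y := fun k => w ^+ (2 * n) * iter k (@theta K) F).
  have -> : w ^+ (2 * n) = w ^+ (2 * (n - k)) * w ^+ (2 * k).
    by rewrite -exprD -mulnDr subnK // ltnW.
  by rewrite -mulrA rpredM ?rpredX ?eval_series_adjoin ?fps_adjoin_iter_theta.
exists Q, n; split=> //; apply: (mulfI (expf_neq0 (2 * n) (eval_series_deriv_neq0 min_P))).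
by rewrite mulr0 -[RHS]rel mulr_sumr; apply: eq_bigr => k _; rewrite mulrCA.
Qed.

Lemma differential_equation_precursive F Q n : Q != 0 -> (size Q <= n)%N ->
  \sum_(k < n) phi Q`_k * iter k (@theta K) F = 0 -> exists r, precursive r (fcoef F).
Proof.
move=> nz_Q le_Qn rel; pose d := (sizeY Q).-1.
have sizeYQ : sizeY Q = d.+1 by rewrite prednK // lt0n sizeY_eq0.
exists d, (\poly_(i < d.+1) shiftp i (swapXY Q)`_(d - i)); split; first 1 last.
- exact: size_poly.
- exists 0%N => // N _.
  have := congr1 (fun a => fcoef a (N + d)) rel; rewrite fcoef_sum /= => rel_N.
  rewrite (diffop_widen _ _ (size_poly _ _)) -[RHS]rel_N.
  transitivity (\sum_(i < d.+1) \sum_(k < n) Q`_k`_(d - i) * ((N + i)%:R ^+ k * fcoef F (N + i))).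
    apply: eq_bigr => i _; rewrite coef_poly ltn_ord horner_shiftp_natr (@horner_coef_wide _ n).
      by rewrite mulr_suml; apply: eq_bigr => k _; rewrite coef_swapXY mulrA.
    apply/leq_sizeP => k le_nk; rewrite coef_swapXY [Q`_k]nth_default ?coef0 //.
    exact: leq_trans le_Qn le_nk.
  rewrite exchange_big; apply: eq_bigr => k _.
  rewrite -[RHS]/(fcoef (phi Q`_k * iter k (@theta K) F) (N + d)).
  rewrite fcoef_polyM -?sizeYQ ?max_size_coefXY //.
  by apply: eq_bigr => i _; rewrite fcoef_iter_theta.
apply/negP => /eqP/(congr1 (fun R : {poly {poly K}} => R`_0))/eqP.
rewrite coef_poly coef0 subn0 shiftp_eq0 /d sizeYE -lead_coefE lead_coef_eq0 swapXY_eq0.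
by rewrite (negPf nz_Q).
Qed.

Lemma fcoefM_low a b i j : (forall l, (l < i)%N -> fcoef a l = 0) ->
  (forall l, (l < j)%N -> fcoef b l = 0) -> fcoef (a * b) (i + j) = fcoef a i * fcoef b j.
Proof.
move=> a_low b_low; have lt_i : (i < (i + j).+1)%N by rewrite ltnS leq_addr.
rewrite /= (bigD1 (Ordinal lt_i)) //= addKn big1 ?addr0 // => l ne_l.
case: (ltngtP l i) => [/a_low->|lt_il|eq_l]; first by rewrite mul0r.
  by rewrite b_low ?mulr0 // ltn_subLR ?ltn_add2r // -ltnS.
by case/eqP: ne_l; apply: val_inj.
Qed.

Lemma fcoef_polyCM (k : K) a n : fcoef (phi k%:P * a) n = k * fcoef a n.
Proof.
by rewrite -[n in LHS]addn0 (@fcoef_polyM _ 0) ?size_polyC_leq1 // big_ord1 coefC addn0.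
Qed.

Lemma theta_proportional a b : b != 0 -> theta a * b = a * theta b ->
  exists k : K, a = phi k%:P * b.
Proof.
move=> nz_b wronskian; have [i nz_bi b_low] := fps_neq0_order nz_b.
pose k := fcoef a i / fcoef b i; exists k; apply/eqP; rewrite -subr_eq0.
apply: contraT; set t := a - _ => nz_t.
have t_wronskian : theta t * b = t * theta b.
  rewrite /t raddfB mulrBl /= wronskian thetaM theta_fps_of_poly /theta_poly derivC mulr0.
  by rewrite rmorph0; ring.
have [j nz_tj t_low] := fps_neq0_order nz_t.
have ti0 : fcoef t i = 0.
  by rewrite -[LHS]/(fcoef a i - fcoef (phi k%:P * b) i) fcoef_polyCM divfK // subrr.
have theta_low (c : fps K) d : (forall l, (l < d)%N -> fcoef c l = 0) ->
    forall l, (l < d)%N -> fcoef (theta c) l = 0.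
  by move=> c_low l lt_ld; rewrite /= c_low ?mulr0.
have := congr1 (fun x : fps K => fcoef x (j + i)) t_wronskian.
rewrite (fcoefM_low (theta_low _ _ t_low) b_low) (fcoefM_low t_low (theta_low _ _ b_low)) /=.
move/eqP; rewrite -mulrA mulrCA -subr_eq0 -mulrBr -mulrBl !mulf_eq0.
rewrite (negPf nz_tj) (negPf nz_bi) /= orbF subr_eq0 (inj_eq (pchar0_natr_inj pchar0)).
move=> /eqP eq_ji; by move: nz_tj; rewrite eq_ji ti0 eqxx.
Qed.

Lemma minimal_equation_theta y P (A B : {poly K}) : minimal_equation y P ->
  phi B * theta y = phi A ->
  lead_coef P *: (B *: map_poly (@theta_poly K) P + A *: P^`())
    = (B * theta_poly (lead_coef P)) *: P.
Proof.
move=> min_P theta_y; have [nz_P Py min] := min_P; apply/eqP; rewrite -subr_eq0; apply/eqP/min.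
  have [m sizeP] := size_minimal_equation min_P; rewrite sizeP ltnS; apply/leq_sizeP => j le_mj.
  have Pj1 : P`_j.+1 = 0 by rewrite nth_default // sizeP.
  rewrite coefB !coefZ coefD !coefZ coef_map coef_deriv Pj1 mul0rn mulr0 addr0 lead_coefE sizeP.
  have [->|ne_j] := eqVneq j m.+1; first by rewrite /=; ring.
  by rewrite [P`_j]nth_default ?raddf0 ?mulr0 ?subrr // sizeP ltn_neqAle eq_sym ne_j.
have := theta_eval_series y P; rewrite Py raddf0 => theta_Py.
rewrite raddfB /= !eval_seriesZ raddfD /= !eval_seriesZ Py mulr0 subr0 -theta_y.
by rewrite -mulrA -mulrDr [theta y * _]mulrC -theta_Py !mulr0.
Qed.

(* If the minimal equation is [l y^(m+1) + p y^m + ... = 0], its derivative in degree [m] says that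
   [p / l + (m + 1) y] is a constant. *)
Lemma rational_of_theta_rational y (A B : {poly K}) : fps_algebraic y -> B != 0 ->
  phi B * theta y = phi A -> exists2 v : {poly K}, v != 0 & exists u, phi v * y = phi u.
Proof.
move=> y_alg nz_B theta_y; have [P min_P] := fps_algebraic_minimal_equation y_alg.
have [m sizeP] := size_minimal_equation min_P; have [nz_P _ _] := min_P.
set l := lead_coef P; have nz_l : l != 0 by rewrite lead_coef_eq0.
have def_l : P`_m.+1 = l by rewrite /l lead_coefE sizeP.
have := congr1 (fun Q : {poly {poly K}} => phi Q`_m) (minimal_equation_theta min_P theta_y).
rewrite /= !coefZ coefD !coefZ coef_map coef_deriv def_l -/l /= => coef_m.
pose s := phi P`_m + m.+1%:R * (phi l * y).
have [||k def_s] := @theta_proportional s (phi l).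
- by rewrite fps_of_poly_eq0.
- have nz_phiB : phi B != 0 by rewrite fps_of_poly_eq0.
  apply: (mulfI nz_phiB); have theta_m x : theta (m.+1%:R * x) = m.+1%:R * theta x.
    by rewrite !mulr_natl raddfMn.
  rewrite /s raddfD /= theta_m thetaM !theta_fps_of_poly.
  move: (theta_poly _) (theta_poly _) coef_m => tl tm.
  rewrite !rmorphM rmorphD !rmorphM rmorphMn /= -mulr_natl -theta_y => coef_m.
  apply/eqP; rewrite -subr_eq0; apply/eqP; move/eqP: coef_m; rewrite -subr_eq0 => /eqP <-.
  by ring.
exists (m.+1%:R * l); first by rewrite mulf_neq0 // -polyC_natr polyC_eq0 pchar0_natr_eq0.
exists (k%:P * l - P`_m); rewrite rmorphB !rmorphM rmorph_nat /= -def_s /s.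
by rewrite addrAC subrr add0r mulrA.
Qed.

Lemma periodic_fps_rational a (R : nat) :
  (forall n, (0 < n)%N -> fcoef a (n + R) = fcoef a n) ->
  exists A, phi (1 - 'X^R) * a = phi A.
Proof.
move=> a_per; exists (\poly_(n < R.+1) fcoef (phi (1 - 'X^R) * a) n); apply: fpsP => n.
rewrite [RHS]coef_poly; case: ltnP => // lt_Rn.
have le_Rn := ltnW lt_Rn; rewrite -(subnK le_Rn) rmorphB rmorph1 mulrBl mul1r.
rewrite -[LHS]/(fcoef a _ - fcoef (phi 'X^R * a) _) a_per ?subn_gt0 //.
rewrite fcoef_polyM ?size_polyXn // big_ord_recl coefXn subn0 eqxx mul1r addn0.
rewrite big1 ?addr0 ?subrr // => i _; rewrite coefXn lift0.
by rewrite (_ : (R - i.+1 == R)%N = false) ?mul0r //; have := ltn_ord i; lia.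
Qed.

Lemma partial_fractions_eq0 m (c : 'I_m -> K) (a b : nat) : (0 < a)%N -> (0 < b)%N ->
  (\forall t \near \oo, \sum_i c i / (a * t + b + i)%:R = 0) -> forall i, c i = 0.
Proof.
move=> a_gt0 b_gt0 sum0 i.
pose S : {poly K} := \sum_i (c i)%:P * \prod_(j < m | j != i) ('X + j%:R%:P).
have S0 : S = 0.
  apply: (poly_eq0_progression pchar0 (b := b) a_gt0); apply: filterS sum0 => t sum0.
  transitivity ((\prod_(j < m) (a * t + b + j)%:R) * \sum_i c i / (a * t + b + i)%:R);
    last by rewrite sum0 mulr0.
  rewrite horner_sum mulr_sumr; apply: eq_bigr => k _; rewrite hornerM hornerC horner_prod.
  rewrite [in RHS](bigD1 k) //= [RHS]mulrAC [X in _ = X * _]mulrCA.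
  have nz_k : (a * t + b + k)%:R != 0 :> K by rewrite pchar0_natr_eq0 //; lia.
  rewrite mulfV // mulr1; congr (_ * _).
  by apply: eq_bigr => j _; rewrite hornerD hornerX hornerC [RHS]natrD.
have /eqP := congr1 (horner^~ (- i%:R)) S0; rewrite /= horner0 horner_sum (bigD1 i) //=.
rewrite [X in _ + X]big1 ?addr0 => [|k ne_ki]; last first.
  rewrite hornerM horner_prod (bigD1 i) /=; last by rewrite eq_sym.
  by rewrite hornerD hornerX !hornerC addNr mul0r mulr0.
rewrite hornerM hornerC mulf_eq0 => /orP[/eqP//|]; rewrite horner_prod prodf_seq_eq0.
case/hasP => j _ /andP[ne_ji]; rewrite hornerD hornerX hornerC addrC subr_eq0.
rewrite (inj_eq (pchar0_natr_inj pchar0)) => /eqP eq_ji.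
by case/eqP: ne_ji; apply: val_inj.
Qed.

Lemma rational_periodic_theta_eq0 y (u v : {poly K}) (R : nat) : v != 0 -> (0 < R)%N ->
  phi v * y = phi u ->
  (forall n, (0 < n)%N -> fcoef (theta y) (n + R) = fcoef (theta y) n) -> theta y = 0.
Proof.
move=> nz_v R_gt0 eq_y theta_per; apply: fpsP => -[|r]; first by rewrite /= mul0r.
pose d := (size v).-1; have size_v : size v = d.+1 := polySpred nz_v.
have per_t t n : (0 < n)%N -> fcoef (theta y) (R * t + n) = fcoef (theta y) n.
  move=> n_gt0; elim: t => [|t IHt]; first by rewrite muln0.
  by rewrite mulnS -addnA addnC theta_per ?IHt // addn_gt0 n_gt0 orbT.
have c0 := @partial_fractions_eq0 d.+1 (fun i => v`_(d - i) * fcoef (theta y) (r.+1 + i))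
  R r.+1 R_gt0 isT.
have /c0/(_ ord0)/eqP : \forall t \near \oo,
    \sum_(i < d.+1) v`_(d - i) * fcoef (theta y) (r.+1 + i) / (R * t + r.+1 + i)%:R = 0.
  exists (size u) => // t le_ut.
  have : fcoef (phi v * y) (R * t + r.+1 + d) = u`_(R * t + r.+1 + d) by rewrite eq_y.
  rewrite fcoef_polyM ?size_v // [u`__]nth_default => [sum0|]; last first.
    by rewrite (leq_trans le_ut) // -addnA (leq_trans (leq_pmull t R_gt0)) ?leq_addr.
  rewrite -[RHS]sum0; apply: eq_bigr => i _; rewrite -(per_t t) // addnA /= -mulrA.
  by rewrite mulrAC mulfV ?mul1r // pchar0_natr_eq0 //; lia.
rewrite subn0 addn0 mulf_eq0 -lead_coefE lead_coef_eq0 (negPf nz_v) => /eqP.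
exact.
Qed.

Lemma algebraic_periodic_theta_eq0 y (R : nat) : fps_algebraic y -> (0 < R)%N ->
  (forall n, (0 < n)%N -> fcoef (theta y) (n + R) = fcoef (theta y) n) -> theta y = 0.
Proof.
move=> y_alg R_gt0 theta_per; have [A theta_rat] := periodic_fps_rational theta_per.
have nz_B : 1 - 'X^R != 0 :> {poly K}.
  apply/eqP => /(congr1 (fun p : {poly K} => p`_0)); rewrite coefB coef1 coefXn coef0.
  by rewrite (ltn_eqF R_gt0) subr0 => /eqP; rewrite oner_eq0.
have [v nz_v [u eq_y]] := rational_of_theta_rational y_alg nz_B theta_rat.
exact: rational_periodic_theta_eq0 nz_v R_gt0 eq_y theta_per.
Qed.

End AlgebraicSeries.

(** * Algebraic generating functions of multiplicative functions *)

Section Twist.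
Variables (C : fieldType) (f : nat -> C) (k : int).
Hypothesis pchar0 : has_pchar0 C.

Definition twist (n : nat) : C := f n / n%:R ^ k.

Lemma twistK n : (0 < n)%N -> f n = n%:R ^ k * twist n.
Proof.
by move=> n_gt0; rewrite mulrC divfK // expfz_neq0 // pchar0_natr_eq0 // -lt0n.
Qed.

Lemma twistM m n : f (m * n)%N = f m * f n -> twist (m * n) = twist m * twist n.
Proof. by rewrite /twist natrM expfzMl invfM mulrACA => ->. Qed.

Lemma twist_multiplicative : multiplicative_fun f -> multiplicative_fun twist.
Proof. by move=> f_mul m n m_gt0 n_gt0 cop; apply/twistM/f_mul. Qed.

Lemma twist_unit_multiplier a : (0 < a)%N -> unit_multiplier f a -> unit_multiplier twist a.
Proof.
move=> a_gt0 [nz_fa fa]; split=> [|n n_gt0]; last exact/twistM/fa.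
by rewrite mulf_neq0 // invr_eq0 expfz_neq0 // pchar0_natr_eq0 // -lt0n.
Qed.

Lemma precursive_twist r : precursive r f -> precursive r twist.
Proof.
have near_gt0 : \forall n \near \oo, (0 < n)%N by exists 1%N.
case def_k: k => [j|j].
  apply: (@precursive_ratfun_mul _ _ _ _ 1 'X^j); rewrite ?monic_neq0 ?monicXn //.
  apply: filterS near_gt0 => n /twistK->.
  by rewrite hornerXn hornerC mul1r def_k.
apply: (@precursive_ratfun_mul _ _ _ _ 'X^(j.+1) 1); rewrite ?oner_eq0 //.
exists 0%N => // n _; rewrite hornerXn hornerC mul1r /twist def_k mulrC.
by rewrite NegzE -exprnN invrK.
Qed.

End Twist.

Lemma precursive_multiplicative_twist_periodic (C : closedFieldType) (f : nat -> C) r :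
  has_pchar0 C -> multiplicative_fun f -> precursive r f -> ~ eventually_zero f ->
  exists k, periodic_fun (twist f k).
Proof.
move=> pchar0 f_mul f_rec f_nz.
have [Q Q_gt0 f_unit] := coprime_unit_multiplier f_mul pchar0 f_rec f_nz.
have [R [k [R_gt0 Q_dvd_R law]]] := power_law pchar0 f_rec Q_gt0 f_unit; exists k.
apply: (unit_multiplier_periodic pchar0 (precursive_twist k pchar0 f_rec) R_gt0) => [a a_gt0 cop|t].
  exact/twist_unit_multiplier/f_unit/(coprime_dvdr Q_dvd_R).
by rewrite /twist law divff // expfz_neq0 // pchar0_natr_eq0 // addn1.
Qed.

Lemma number_field_closed_extension (K : fieldExtType rat) :
  {C : closedFieldType & {rmorphism K -> C}}.
Proof.
pose cK := CanIsCountable (@VectorInternalTheory.v2rK rat K).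
pose K' : countFieldType := HB.pack_for countFieldType (K : Type) (GRing.Field.on K) cK.
by have [C [iota _]] := countable_algebraic_closure K'; exists C.
Qed.

Lemma precursive_multiplicative_twist_periodic_number_field (K : fieldExtType rat)
    (f : nat -> K) r :
  multiplicative_fun f -> precursive r f -> ~ eventually_zero f ->
  exists k, periodic_fun (twist f k).
Proof.
move=> f_mul f_rec f_nz; have [C iota] := number_field_closed_extension K.
have pchar0 : has_pchar0 C.
  by move=> p; rewrite (fmorph_pchar iota) pchar_lalg Num.Theory.pchar_num.
have iota_mul : multiplicative_fun (iota \o f).
  by move=> m n m_gt0 n_gt0 cop; rewrite /= f_mul // rmorphM.
have iota_nz : ~ eventually_zero (iota \o f).
  by move=> [N f0]; apply: f_nz; exists N => n /f0/eqP; rewrite fmorph_eq0 => /eqP.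
have [k [d d_gt0 per]] :=
  precursive_multiplicative_twist_periodic pchar0 iota_mul (precursive_map iota f_rec) iota_nz.
exists k, d => // n n_gt0; apply: (fmorph_inj iota).
have iota_twist l : iota (twist f k l) = twist (iota \o f) k l.
  by rewrite /twist fmorph_div fmorphXz rmorph_nat.
by rewrite !iota_twist per.
Qed.

Lemma algebraic_twist_exponent_nat (K : fieldType) (f : nat -> K) (k : int) : has_pchar0 K ->
  fps_algebraic (gen_fps f) -> f 1%N = 1 -> periodic_fun (twist f k) -> exists j : nat, k = j.
Proof.
move=> pchar0 F_alg f1 [d d_gt0 per]; case: k per => [j|j] per; first by exists j.
have theta_f n : (0 < n)%N ->
    fcoef (iter j.+1 (@theta K) (gen_fps f)) n = twist f (Negz j) n.
  move=> n_gt0; rewrite fcoef_iter_theta /= (gtn_eqF n_gt0) /twist NegzE -exprnN invrK.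
  exact: mulrC.
have := @algebraic_periodic_theta_eq0 K pchar0 (iter j (@theta K) (gen_fps f)) d.
rewrite -iterS => /(_ (fps_algebraic_iter_theta pchar0 j F_alg) d_gt0) theta0.
have {theta0}/(congr1 (fun a => fcoef a 1)) : iter j.+1 (@theta K) (gen_fps f) = 0.
  by apply: theta0 => n n_gt0; rewrite !theta_f ?per // addn_gt0 n_gt0.
by rewrite theta_f // /twist f1 exp1rz divr1 => /eqP; rewrite oner_eq0.
Qed.

Theorem theorem4p1 (K : fieldExtType rat) (f : nat -> K)
  (f_mul : multiplicative_fun f)
  (F_alg : fps_algebraic (gen_fps f)) :
  eventually_zero f \/
  exists (k : nat) (chi : nat -> K),
    [/\ periodic_fun chi,
        multiplicative_fun chi &
        forall n : nat, (0 < n)%N -> f n = n%:R ^+ k * chi n].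
Proof.
case: (pselect (eventually_zero f)) => [|f_nz]; [by left|right].
have pchar0 : has_pchar0 K by move=> p; rewrite pchar_lalg Num.Theory.pchar_num.
have [Q [n [nz_Q le_Qn diff_eq]]] := fps_algebraic_differential_equation pchar0 F_alg.
have [r F_rec] := differential_equation_precursive nz_Q le_Qn diff_eq.
have f_rec : precursive r f.
  apply: (precursive_ratfun_mul (oner_neq0 _) _ F_rec (p := 1)).
  by exists 1%N => // -[|m] //= _.
have [k per] := precursive_multiplicative_twist_periodic_number_field f_mul f_rec f_nz.
have [j def_k] := algebraic_twist_exponent_nat pchar0 F_alg (multiplicative_fun1 f_mul f_nz) per.
exists j, (twist f k); split=> //; first exact: twist_multiplicative.
by move=> m m_gt0; rewrite [LHS](twistK f k pchar0 m_gt0) def_k.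
Qed.
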